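(* Let $V$ be the standard (type I) representation of $U_q(\mathfrak{gl}_2)$ with basis $\{x,y\}$, and view the tensor powers $V^{\otimes n}$ ($n\ge 1$) as modules over the coideal subalgebra $U^\iota=U_q'(\mathfrak{gl}_1\times\mathfrak{gl}_1)\subseteq U_q(\mathfrak{gl}_2)$ generated by $C^{\pm1}$ and $B=q^{-1}EK^{-1}+F$. For $n\in\mathbb{Z}$ put $$v_n=x+q^n y,\qquad w_n=x-q^{-n}y\qquad\text{in }V .$$ Then: (i) $V=\langle v_0\rangle\oplus\langle w_0\rangle$ is a decomposition into two one-dimensional $U^\iota$-subrepresentations, which are eigenspaces of $B$ with eigenvalues $1$ and $-1$ respectively. (ii) Let $M$ be a $U^\iota$-module and $z\in M$ an eigenvector of $B$ with eigenvalue $[n]$, $n\in\mathbb{Z}$. Then $z\otimes v_n\in M\otimes V$ is an eigenvector of $B$ with eigenvalue $[n+1]$. (iii) Let $M$ be a $U^\iota$-module and $z\in M$ an eigenvector of $B$ with eigenvalue $[n]$, $n\in\mathbb{Z}$. Then $z\otimes w_n\in M\otimes V$ is an eigenvector of $B$ with eigenvalue $[n-1]$. (iv) For every $n\geq 1$ the $U^\iota$-module $V^{\otimes n}$ decomposes into one-dimensional subrepresentations as $$V^{\otimes n}=\bigoplus_{k=0}^{n}\binom{n}{k}\,L([n-2k]),$$ i.e. $L([n-2k])$ occurs with multiplicity $\binom nk$, where $L([n-2k])$ denotes the one-dimensional representation of $U^\iota$ on which $C$ acts by $q^n$ and $B$ acts by the quantum integer $[n-2k]$.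
   Context: The ground field is $\mathbb{C}(q)$. For $n\in\mathbb{Z}$, $[n]=\frac{q^n-q^{-n}}{q-q^{-1}}$. $U_q(\mathfrak{gl}_2)$ is the unital associative $\mathbb{C}(q)$-algebra with generators $E,F,D_1^{\pm1},D_2^{\pm1}$ and relations: $D_1,D_2$ commute and are invertible with inverses $D_i^{-1}$; $D_1ED_1^{-1}=qE$, $D_2ED_2^{-1}=q^{-1}E$, $D_1FD_1^{-1}=q^{-1}F$, $D_2FD_2^{-1}=qF$; $EF-FE=\frac{K-K^{-1}}{q-q^{-1}}$ with $K:=D_1D_2^{-1}$. The comultiplication is $\Delta(E)=E\otimes 1+K\otimes E$, $\Delta(F)=F\otimes K^{-1}+1\otimes F$, $\Delta(D_i)=D_i\otimes D_i$. The standard (type I) representation $V$ has basis $x,y$ with $Ex=0$, $Ey=x$, $Fx=y$, $Fy=0$, $D_1x=qx$, $D_1y=y$, $D_2x=x$, $D_2y=qy$. $U^\iota=U_q'(\mathfrak{gl}_1\times\mathfrak{gl}_1)$ is the subalgebra of $U_q(\mathfrak{gl}_2)$ generated by $C:=D_1D_2$, $C^{-1}$ and $B:=q^{-1}EK^{-1}+F$. It is a right coideal: $\Delta(U^\iota)\subseteq U^\iota\otimes U_q(\mathfrak{gl}_2)$, with $\Delta(B)=B\otimes K^{-1}+1\otimes B$. Hence if $M$ is a $U^\iota$-module and $W$ a $U_q(\mathfrak{gl}_2)$-module, $M\otimes W$ is a $U^\iota$-module via $\Delta$. *)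

(* Defs.v *)
From HB Require Import structures.
From mathcomp Require Import all_boot all_order all_algebra generic_quotient.
From mathcomp Require Import boolp classical_sets reals complex.
Set Implicit Arguments.
Unset Strict Implicit.
Unset Printing Implicit Defensive.
Import GRing.Theory.
Local Open Scope ring_scope.
Local Open Scope quotient_scope.
Local Open Scope classical_set_scope.

Section Complement.
Variables (K : fieldType) (A B : lmodType K) (i : {linear A -> B}).
Hypothesis i_inj : injective i.

(* Linear injections over a field split (in arbitrary dimension). *)
Lemma linear_retract : exists r : {linear B -> A}, forall a, r (i a) = a.
Proof.
pose P : set (set B) := fun S => (forall c s t, S s -> S t -> S (c *: s + t)) /\
  (forall a, S (i a) -> a = 0).
have [F FP Ft|S [[Slin Si] Smax]] := @Zorn_bigcup B P.
  split=> [c s t [X FX Xs] [Y FY Yt]|a [X FX]]; last by have [_] := FP _ FX; apply.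
  have [XY|YX] := Ft _ _ FX FY.
    by exists Y => //; have [+ _] := FP _ FY; apply=> //; apply: XY.
  by exists X => //; have [+ _] := FP _ FX; apply=> //; apply: YX.
have S0 : S 0.
  apply: contrapT => nS0; apply: (Smax (S `|` [set 0])).
    by split=> [x ?|sub]; [left | apply: nS0; apply: sub; right].
  split=> [c s t [Ss|->] [St|->]|a [/Si//|]].
  - by left; apply: Slin.
  - rewrite addr0; have [->|cn0] := eqVneq c 0; first by rewrite scale0r; right.
    left; rewrite -[c]subr0; have -> : c - 0 = (c - 1) + 1 by rewrite subrK subr0.
    by rewrite scalerDl scale1r; apply: Slin.
  - by rewrite scaler0 add0r; left.
  - by rewrite scaler0 add0r; right.
  - by move=> ia0; apply: i_inj; rewrite ia0 linear0.
have dec b : exists a, S (b - i a).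
  apply: contrapT => nb; pose T := [set x | exists c s, S s /\ x = s + c *: b].
  have ST : S `<=` T by move=> s Ss; exists 0, s; rewrite scale0r addr0.
  have Tb : T b by exists 1, 0; rewrite scale1r add0r.
  apply: (Smax T); first by split=> // /(_ _ Tb) Sb; apply: nb; exists 0;
    rewrite linear0 subr0.
  split=> [c _ _ [c1 [s1 [Ss1 ->]]] [c2 [s2 [Ss2 ->]]]|a [c [s [Ss ia]]]].
    exists (c * c1 + c2), (c *: s1 + s2); split; first exact: Slin.
    by rewrite /= [in RHS]scalerDl -scalerA [in RHS]addrACA -scalerDr.
  have [c0|cn0] := eqVneq c 0.
    by apply: Si; rewrite ia c0 scale0r addr0.
  case: nb; exists (c^-1 *: a); rewrite linearZ /= ia scalerDr scalerA mulVf //.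
  by rewrite scale1r opprD addrCA subrr addr0 -scaleNr -[X in S X]addr0; apply: Slin.
pose r b := xget 0 [set a | S (b - i a)].
have rP b : S (b - i (r b)) by rewrite /r; case: xgetP => // nb; have [a /nb] := dec b.
have rU b a : S (b - i a) -> r b = a.
  move=> Sa; apply/eqP; rewrite -subr_eq0; apply/eqP/Si.
  have := Slin (-1) _ _ (rP b) Sa; congr S.
  by rewrite scaleN1r (linearB i) opprB addrA subrK.
have rL : linear r.
  move=> c b b'; apply: rU; rewrite linearP opprD addrACA.
  by rewrite -scalerN -scalerDr; apply: Slin.
pose rM := GRing.isLinear.Build K B A _ r rL.
pose rl : {linear B -> A} := HB.pack r rM.
by exists rl => a; apply: rU; rewrite subrr.
Qed.

End Complement.

(* The tensor product over K of two arbitrary K-vector spaces, presented by the *)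
(* pure tensors subject to bilinearity.                                          *)
Section Tensor.
Variables (K : fieldType) (M N : lmodType K).

Inductive tensor_term : Type :=
| TPure of M & N
| TAdd of tensor_term & tensor_term
| TScale of K & tensor_term.

Inductive tensor_eq : tensor_term -> tensor_term -> Prop :=
| teq_refl s : tensor_eq s s
| teq_sym s t : tensor_eq s t -> tensor_eq t s
| teq_trans s t u : tensor_eq s t -> tensor_eq t u -> tensor_eq s u
| teq_add s s' t t' : tensor_eq s s' -> tensor_eq t t' ->
    tensor_eq (TAdd s t) (TAdd s' t')
| teq_scale a s s' : tensor_eq s s' -> tensor_eq (TScale a s) (TScale a s')
| teq_addA s t u : tensor_eq (TAdd s (TAdd t u)) (TAdd (TAdd s t) u)
| teq_addC s t : tensor_eq (TAdd s t) (TAdd t s)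
| teq_add0 s : tensor_eq (TAdd (TPure 0 0) s) s
| teq_addN s : tensor_eq (TAdd (TScale (-1) s) s) (TPure 0 0)
| teq_scaleA a b s : tensor_eq (TScale a (TScale b s)) (TScale (a * b) s)
| teq_scale1 s : tensor_eq (TScale 1 s) s
| teq_scaleDr a s t :
    tensor_eq (TScale a (TAdd s t)) (TAdd (TScale a s) (TScale a t))
| teq_scaleDl a b s :
    tensor_eq (TScale (a + b) s) (TAdd (TScale a s) (TScale b s))
| teq_pureDl m m' n : tensor_eq (TPure (m + m') n) (TAdd (TPure m n) (TPure m' n))
| teq_pureDr m n n' : tensor_eq (TPure m (n + n')) (TAdd (TPure m n) (TPure m n'))
| teq_pureZl a m n : tensor_eq (TPure (a *: m) n) (TScale a (TPure m n))
| teq_pureZr a m n : tensor_eq (TPure m (a *: n)) (TScale a (TPure m n)).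

HB.instance Definition _ := gen_eqMixin tensor_term.
HB.instance Definition _ := gen_choiceMixin tensor_term.

Definition tensor_eqb : rel tensor_term := fun s t => `[< tensor_eq s t >].

Lemma tensor_eqb_equiv : equiv_class_of tensor_eqb.
Proof.
split=> [s|s t|t s u]; first exact/asboolP/teq_refl.
  by apply/asboolP/asboolP; apply: teq_sym.
by move=> /asboolP ? /asboolP ?; apply/asboolP/(@teq_trans _ t).
Qed.
Canonical tensor_equiv := EquivRelPack tensor_eqb_equiv.

Definition tensor : Type := {eq_quot tensor_equiv}.
HB.instance Definition _ := Choice.on tensor.
HB.instance Definition _ : EqQuotient _ tensor_equiv tensor := EqQuotient.on tensor.

Definition tensor_add (x y : tensor) : tensor := \pi_tensor (TAdd (repr x) (repr y)).
Definition tensor_scale a (x : tensor) : tensor := \pi_tensor (TScale a (repr x)).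
Definition pure_tensor m n : tensor := \pi_tensor (TPure m n).

Lemma tensor_piE s t : tensor_eq s t -> \pi_tensor s = \pi_tensor t.
Proof. by move=> st; apply/(@eqquotP _ _ tensor)/asboolP. Qed.

Lemma tensor_reprP s : tensor_eq (repr (\pi_tensor s)) s.
Proof. by apply/asboolP; apply/(@eqquotP _ _ tensor); rewrite reprK. Qed.

Lemma pi_tensor_add s t : tensor_add (\pi_tensor s) (\pi_tensor t) = \pi_tensor (TAdd s t).
Proof. by apply: tensor_piE; apply: teq_add; apply: tensor_reprP. Qed.

Lemma pi_tensor_scale a s : tensor_scale a (\pi_tensor s) = \pi_tensor (TScale a s).
Proof. by apply: tensor_piE; apply: teq_scale; apply: tensor_reprP. Qed.

Lemma tensor_addA : associative tensor_add.
Proof.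
elim/quotW=> s; elim/quotW=> t; elim/quotW=> u.
rewrite (pi_tensor_add t u) (pi_tensor_add s) (pi_tensor_add s t) (pi_tensor_add _ u).
exact/tensor_piE/teq_addA.
Qed.
Lemma tensor_addC : commutative tensor_add.
Proof.
elim/quotW=> s; elim/quotW=> t; rewrite (pi_tensor_add s t) (pi_tensor_add t s).
exact/tensor_piE/teq_addC.
Qed.
Lemma tensor_add0 : left_id (pure_tensor 0 0) tensor_add.
Proof. by elim/quotW=> s; rewrite (pi_tensor_add _ s); exact/tensor_piE/teq_add0. Qed.
Lemma tensor_addN : left_inverse (pure_tensor 0 0) (tensor_scale (-1)) tensor_add.
Proof.
elim/quotW=> s; rewrite (pi_tensor_scale _ s) (pi_tensor_add _ s).
exact/tensor_piE/teq_addN.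
Qed.

HB.instance Definition _ :=
  GRing.isZmodule.Build tensor tensor_addA tensor_addC tensor_add0 tensor_addN.

Lemma tensor_scaleA a b x :
  tensor_scale a (tensor_scale b x) = tensor_scale (a * b) x.
Proof.
elim/quotW: x => s; rewrite (pi_tensor_scale b s) !(pi_tensor_scale _ _).
exact/tensor_piE/teq_scaleA.
Qed.
Lemma tensor_scale1 : left_id 1 tensor_scale.
Proof. by elim/quotW=> s; rewrite (pi_tensor_scale _ s); exact/tensor_piE/teq_scale1. Qed.
Lemma tensor_scaleDr : right_distributive tensor_scale +%R.
Proof.
move=> a; elim/quotW=> s; elim/quotW=> t; rewrite /GRing.add /= (pi_tensor_add s t).
rewrite !(pi_tensor_scale a) (pi_tensor_add (TScale a s)).
exact/tensor_piE/teq_scaleDr.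
Qed.
Lemma tensor_scaleDl x : {morph tensor_scale^~ x : a b / a + b}.
Proof.
elim/quotW: x => s a b; rewrite [in RHS]/GRing.add /= !(pi_tensor_scale _ s).
rewrite (pi_tensor_add (TScale a s)).
exact/tensor_piE/teq_scaleDl.
Qed.

HB.instance Definition _ := GRing.Zmodule_isLmodule.Build K tensor
  tensor_scaleA tensor_scale1 tensor_scaleDr tensor_scaleDl.

Lemma pi_tensorD s t : \pi_tensor (TAdd s t) = \pi_tensor s + \pi_tensor t.
Proof. by rewrite [RHS]pi_tensor_add. Qed.
Lemma pi_tensorZ a s : \pi_tensor (TScale a s) = a *: \pi_tensor s.
Proof. by rewrite [RHS]pi_tensor_scale. Qed.

Lemma pure_tensorDl n : {morph pure_tensor^~ n : m m' / m + m'}.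
Proof. by move=> m m'; rewrite -pi_tensorD; exact/tensor_piE/teq_pureDl. Qed.
Lemma pure_tensorDr m : {morph pure_tensor m : n n' / n + n'}.
Proof. by move=> n n'; rewrite -pi_tensorD; exact/tensor_piE/teq_pureDr. Qed.
Lemma pure_tensorZl a m n : pure_tensor (a *: m) n = a *: pure_tensor m n.
Proof. by rewrite -pi_tensorZ; exact/tensor_piE/teq_pureZl. Qed.
Lemma pure_tensorZr a m n : pure_tensor m (a *: n) = a *: pure_tensor m n.
Proof. by rewrite -pi_tensorZ; exact/tensor_piE/teq_pureZr. Qed.

Lemma tensor_ind (P : tensor -> Prop) :
  (forall m n, P (pure_tensor m n)) -> (forall x y, P x -> P y -> P (x + y)) ->
  forall x, P x.
Proof.
move=> Pp PD; elim/quotW; suff PZ s a : P (a *: \pi_tensor s).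
  by move=> s; rewrite -[X in P X]scale1r.
elim: s a => [m n|s IHs t IHt|b s IHs] a.
- by rewrite -pure_tensorZl.
- by rewrite pi_tensorD scalerDr; apply: PD.
- by rewrite pi_tensorZ scalerA.
Qed.

Section Lift.
Variables (P : lmodType K) (f : M -> N -> P).
Hypotheses (fl : forall n, linear (f^~ n)) (fr : forall m, linear (f m)).

Fixpoint tensor_eval (s : tensor_term) : P :=
  match s with
  | TPure m n => f m n
  | TAdd s t => tensor_eval s + tensor_eval t
  | TScale a s => a *: tensor_eval s
  end.

Definition tensor_lift_fun (x : tensor) : P := tensor_eval (repr x).

Lemma tensor_evalP s t : tensor_eq s t -> tensor_eval s = tensor_eval t.
Proof.
have fDl m m' n : f (m + m') n = f m n + f m' n.
  by have := fl n 1 m m'; rewrite !scale1r.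
have fDr m n n' : f m (n + n') = f m n + f m n'.
  by have := fr m 1 n n'; rewrite !scale1r.
have f0 n : f 0 n = 0 by apply: (addrI (f 0 n)); rewrite -fDl !addr0.
have f0r m : f m 0 = 0 by apply: (addrI (f m 0)); rewrite -fDr !addr0.
elim=> //=.
- by move=> ? ? ? _ -> _ ->.
- by move=> ? ? ? ? _ -> _ ->.
- by move=> ? ? ? _ ->.
- by move=> *; rewrite addrA.
- by move=> *; rewrite addrC.
- by move=> *; rewrite f0 add0r.
- by move=> *; rewrite scaleN1r addNr f0.
- by move=> *; rewrite scalerA.
- by move=> *; rewrite scale1r.
- by move=> *; rewrite scalerDr.
- by move=> *; rewrite scalerDl.
- by move=> a m n; have := fl n a m 0; rewrite f0 !addr0.
- by move=> a m n; have := fr m a n 0; rewrite f0r !addr0.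
Qed.

Lemma tensor_lift_pi s : tensor_lift_fun (\pi_tensor s) = tensor_eval s.
Proof. exact/tensor_evalP/tensor_reprP. Qed.

Lemma tensor_lift_linear : linear tensor_lift_fun.
Proof.
move=> a; elim/quotW=> s; elim/quotW=> t.
by rewrite -pi_tensorZ -pi_tensorD !tensor_lift_pi.
Qed.

HB.instance Definition _ :=
  GRing.isLinear.Build K tensor P *:%R tensor_lift_fun tensor_lift_linear.

Definition tensor_lift : {linear tensor -> P} := tensor_lift_fun.

Lemma tensor_liftE m n : tensor_lift (pure_tensor m n) = f m n.
Proof. exact: tensor_lift_pi. Qed.

End Lift.

End Tensor.

Arguments tensor {K} M N.
Notation "m ⊗ n" := (pure_tensor m n) (at level 40, left associativity) : ring_scope.

Section TensorMap.
Variables (K : fieldType) (M M' N N' : lmodType K).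
Variables (f : {linear M -> M'}) (g : {linear N -> N'}).

Fact tensor_map_linl n : linear (fun m => f m ⊗ g n).
Proof. by move=> a m m'; rewrite linearP pure_tensorDl pure_tensorZl. Qed.
Fact tensor_map_linr m : linear (fun n => f m ⊗ g n).
Proof. by move=> a n n'; rewrite linearP pure_tensorDr pure_tensorZr. Qed.

Definition tensor_map : {linear tensor M N -> tensor M' N'} :=
  tensor_lift tensor_map_linl tensor_map_linr.

Lemma tensor_mapE m n : tensor_map (m ⊗ n) = f m ⊗ g n.
Proof. exact: tensor_liftE. Qed.

End TensorMap.

Section TensorMapTheory.
Variable K : fieldType.

Lemma tensor_map_injl (M M' N : lmodType K) (f : {linear M -> M'}) :
  injective f -> injective (tensor_map f (idfun : {linear N -> N})).
Proof.
move=> /linear_retract[r rP]; apply: (can_inj (g := tensor_map r idfun)).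
apply: tensor_ind => [m n|x y IHx IHy]; first by rewrite !tensor_mapE /= rP.
by rewrite !linearD IHx IHy.
Qed.

Lemma line_functional (M : lmodType K) (m : M) : m != 0 ->
  exists f : {linear M -> K^o}, f m = 1.
Proof.
move=> m0; have sl : linear (fun a : K^o => a *: m).
  by move=> c a b; rewrite scalerDl scalerA.
pose sM := GRing.isLinear.Build K K^o M _ _ sl.
pose s : {linear K^o -> M} := HB.pack (fun a : K^o => a *: m) sM.
have [|r rP] := @linear_retract K K^o M s.
  move=> a b /= /eqP; rewrite -subr_eq0 -scalerBl scaler_eq0 (negPf m0) orbF.
  by rewrite subr_eq0 => /eqP.
by exists r; rewrite -[in LHS](scale1r m) (rP 1).
Qed.

Lemma pure_tensor_neq0 (M N : lmodType K) (m : M) (n : N) :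
  m != 0 -> n != 0 -> m ⊗ n != 0.
Proof.
move=> /line_functional[f fm] /line_functional[g gn]; apply/eqP => mn0.
have lin1 b : linear (fun a : K^o => a * b : K^o).
  by move=> c a a'; rewrite mulrDl scalerAl.
have lin2 a : linear (fun b : K^o => a * b : K^o).
  by move=> c b b'; rewrite mulrDr scalerAr.
have := congr1 (tensor_lift lin1 lin2) (congr1 (tensor_map f g) mn0).
rewrite tensor_mapE tensor_liftE fm gn mulr1 !linear0 => /eqP.
by rewrite oner_eq0.
Qed.

End TensorMapTheory.

Section TensorAlgebra.
Variables (K : fieldType) (A B : algType K).
Notation AB := (tensor A B).

Fact tensor_mulp_linl (a : A) (b : B) b' : linear (fun a' => (a * a') ⊗ (b * b')).
Proof. by move=> c x y; rewrite mulrDr -scalerAr pure_tensorDl pure_tensorZl. Qed.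
Fact tensor_mulp_linr (a : A) (b : B) a' : linear (fun b' => (a * a') ⊗ (b * b')).
Proof. by move=> c x y; rewrite mulrDr -scalerAr pure_tensorDr pure_tensorZr. Qed.

Definition tensor_mulp a b : {linear AB -> AB} :=
  tensor_lift (@tensor_mulp_linl a b) (@tensor_mulp_linr a b).

Fact tensor_mul_linl y b : linear (fun a => tensor_mulp a b y).
Proof.
move=> c a a'; elim/tensor_ind: y => [x z|x z IHx IHz].
  by rewrite !tensor_liftE mulrDl -scalerAl pure_tensorDl pure_tensorZl.
by rewrite !linearD IHx IHz addrACA.
Qed.
Fact tensor_mul_linr y a : linear (fun b => tensor_mulp a b y).
Proof.
move=> c b b'; elim/tensor_ind: y => [x z|x z IHx IHz].
  by rewrite !tensor_liftE mulrDl -scalerAl pure_tensorDr pure_tensorZr.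
by rewrite !linearD IHx IHz addrACA.
Qed.

Definition tensor_mul (x y : AB) : AB :=
  tensor_lift (tensor_mul_linl y) (tensor_mul_linr y) x.
Definition tensor_one : AB := 1 ⊗ 1.

Fact tensor_mul_pure a b a' b' :
  tensor_mul (a ⊗ b) (a' ⊗ b') = (a * a') ⊗ (b * b').
Proof. by rewrite /tensor_mul !tensor_liftE. Qed.
Fact tensor_mulDl : left_distributive tensor_mul +%R.
Proof. by move=> x y z; rewrite /tensor_mul linearD. Qed.
Fact tensor_mulDr : right_distributive tensor_mul +%R.
Proof.
move=> x y z; elim/tensor_ind: x => [a b|x x' IHx IHx'].
  by rewrite /tensor_mul !tensor_liftE linearD.
by rewrite !tensor_mulDl IHx IHx' addrACA.
Qed.
Fact tensor_mulA : associative tensor_mul.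
Proof.
move=> x y z; elim/tensor_ind: x => [a b|x x' IHx IHx']; last first.
  by rewrite !tensor_mulDl IHx IHx'.
elim/tensor_ind: y => [a' b'|y y' IHy IHy']; last first.
  by rewrite !(tensor_mulDr, tensor_mulDl) IHy IHy'.
elim/tensor_ind: z => [a'' b''|z z' IHz IHz']; last by rewrite !tensor_mulDr IHz IHz'.
by rewrite !tensor_mul_pure !mulrA.
Qed.
Fact tensor_mul1l : left_id tensor_one tensor_mul.
Proof.
move=> x; elim/tensor_ind: x => [a b|x y IHx IHy]; last by rewrite tensor_mulDr IHx IHy.
by rewrite tensor_mul_pure !mul1r.
Qed.
Fact tensor_mul1r : right_id tensor_one tensor_mul.
Proof.
move=> x; elim/tensor_ind: x => [a b|x y IHx IHy]; last by rewrite tensor_mulDl IHx IHy.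
by rewrite tensor_mul_pure !mulr1.
Qed.
Fact tensor_one_neq0 : tensor_one != 0.
Proof. by apply: pure_tensor_neq0; apply: oner_neq0. Qed.

HB.instance Definition _ := GRing.Zmodule_isNzRing.Build AB
  tensor_mulA tensor_mul1l tensor_mul1r tensor_mulDl tensor_mulDr tensor_one_neq0.

Fact tensor_scaleAl (c : K) (x y : AB) : c *: (x * y) = (c *: x) * y.
Proof. by rewrite /GRing.mul /= /tensor_mul linearZ. Qed.
HB.instance Definition _ := GRing.Lmodule_isLalgebra.Build K AB tensor_scaleAl.

Lemma tensorM a b a' b' : (a ⊗ b : AB) * (a' ⊗ b') = (a * a') ⊗ (b * b').
Proof. exact: tensor_mul_pure. Qed.

Fact tensor_scaleAr (c : K) (x y : AB) : c *: (x * y) = x * (c *: y).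
Proof.
elim/tensor_ind: x => [a b|x x' IHx IHx']; last by rewrite !mulrDl scalerDr IHx IHx'.
elim/tensor_ind: y => [a' b'|y y' IHy IHy']; last by rewrite !(mulrDr, scalerDr) IHy IHy'.
by rewrite -pure_tensorZl !tensorM -pure_tensorZl scalerAr.
Qed.
HB.instance Definition _ := GRing.Lalgebra_isAlgebra.Build K AB tensor_scaleAr.

Lemma tensor1E : 1 = 1 ⊗ 1 :> AB. Proof. by []. Qed.

End TensorAlgebra.

Record rep (K : fieldType) (A : algType K) := Rep {
  carrier :> lmodType K;
  act : A -> {linear carrier -> carrier};
  act_linear : forall m, linear (fun a => act a m);
  act1 : forall m, act 1 m = m;
  actM : forall a b m, act (a * b) m = act a (act b m)
}.
Arguments act {K A r} a : rename.

(* The module f^*M; restriction to a subalgebra is the case of an inclusion. *)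
Section Pullback.
Variables (K : fieldType) (A B : algType K) (f : {lrmorphism A -> B}) (M : rep B).

Fact pullback_linear (m : M) : linear (fun a => act (f a) m).
Proof. by move=> c a b; rewrite linearP act_linear. Qed.
Fact pullback_act1 (m : M) : act (f 1) m = m.
Proof. by rewrite rmorph1 act1. Qed.
Fact pullback_actM a b (m : M) : act (f (a * b)) m = act (f a) (act (f b) m).
Proof. by rewrite rmorphM actM. Qed.

Definition pullback : rep A :=
  @Rep K A M (fun a => act (f a)) pullback_linear pullback_act1 pullback_actM.

End Pullback.

(* The outer tensor product: (a ⊗ b) (m ⊗ n) = a m ⊗ b n. *)
Section OuterTensor.
Variables (K : fieldType) (A B : algType K) (M : rep A) (N : rep B).

Fact outer_linl (x : tensor M N) b : linear (fun a : A => tensor_map (act a) (act b) x).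
Proof.
move=> c a a'; elim/tensor_ind: x => [m n|x y IHx IHy].
  by rewrite !tensor_mapE act_linear pure_tensorDl pure_tensorZl.
by rewrite !linearD IHx IHy addrACA.
Qed.
Fact outer_linr (x : tensor M N) a : linear (fun b : B => tensor_map (act a) (act b) x).
Proof.
move=> c b b'; elim/tensor_ind: x => [m n|x y IHx IHy].
  by rewrite !tensor_mapE act_linear pure_tensorDr pure_tensorZr.
by rewrite !linearD IHx IHy addrACA.
Qed.

Definition outer_fun (t : tensor A B) (x : tensor M N) : tensor M N :=
  tensor_lift (outer_linl x) (outer_linr x) t.

Fact outer_linear (t : tensor A B) : linear (outer_fun t).
Proof.
move=> c x y; elim/tensor_ind: t => [a b|s t IHs IHt].
  by rewrite /outer_fun !tensor_liftE linearP.
by rewrite /outer_fun !linearD -!/(outer_fun _ _) IHs IHt addrACA.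
Qed.
HB.instance Definition _ t :=
  GRing.isLinear.Build K (tensor M N) (tensor M N) *:%R (outer_fun t) (outer_linear t).
Definition outer_act t : {linear tensor M N -> tensor M N} := outer_fun t.

Fact outer_act_pure a b m n : outer_act (a ⊗ b) (m ⊗ n) = act a m ⊗ act b n.
Proof. by rewrite /= /outer_fun tensor_liftE tensor_mapE. Qed.
Fact outer_act_linear x : linear (fun t => outer_act t x).
Proof. by move=> c s t; rewrite /= /outer_fun linearP. Qed.
Fact outer_actD s t x : outer_act (s + t) x = outer_act s x + outer_act t x.
Proof. by rewrite -[s in LHS]scale1r outer_act_linear scale1r. Qed.
Fact outer_act1 x : outer_act 1 x = x.
Proof.
elim/tensor_ind: x => [m n|x y IHx IHy]; last by rewrite linearD IHx IHy.
by rewrite tensor1E outer_act_pure !act1.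
Qed.
Fact outer_actM s t x : outer_act (s * t) x = outer_act s (outer_act t x).
Proof.
elim/tensor_ind: s => [a b|s s' IHs IHs']; last by rewrite mulrDl !outer_actD IHs IHs'.
elim/tensor_ind: t => [a' b'|t t' IHt IHt'].
  elim/tensor_ind: x => [m n|x y IHx IHy]; last by rewrite !linearD IHx IHy.
  by rewrite tensorM !outer_act_pure !actM.
by rewrite mulrDr !outer_actD linearD IHt IHt'.
Qed.

Definition outer_tensor : rep (tensor A B) := Rep outer_act_linear outer_act1 outer_actM.

End OuterTensor.

Arguments outer_act {K A B M N} t.

Section GeneratedSubalgebra.
Variables (K : fieldType) (A : algType K) (S : set A).

Inductive in_subalg : A -> Prop :=
| sub_gen a of S a : in_subalg a
| sub_one : in_subalg 1
| sub_add a b of in_subalg a & in_subalg b : in_subalg (a + b)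
| sub_mul a b of in_subalg a & in_subalg b : in_subalg (a * b)
| sub_scale c a of in_subalg a : in_subalg (c *: a).

Definition gen_subalg : {pred A} := fun a => `[< in_subalg a >].

Fact gen_subalg_closed : GRing.subalg_closed gen_subalg.
Proof.
split=> [|c a b /asboolP ? /asboolP ?|a b /asboolP ? /asboolP ?]; apply/asboolP.
- exact: sub_one.
- by apply: sub_add => //; apply: sub_scale.
- exact: sub_mul.
Qed.
HB.instance Definition _ := GRing.isSubalgClosed.Build K A gen_subalg gen_subalg_closed.

Definition subalg : Type := {a : A | a \in gen_subalg}.
HB.instance Definition _ := [isSub of subalg for @sval _ _].
HB.instance Definition _ := [Choice of subalg by <:].
HB.instance Definition _ := [SubChoice_isSubAlgebra of subalg by <:].

Definition subalg_val (a : subalg) : A := val a.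
Fact subalg_val_linear : linear subalg_val. Proof. exact: (linearP val). Qed.
Fact subalg_val_monoid : monoid_morphism subalg_val.
Proof. by split=> [|a b]; [exact: (rmorph1 val) | exact: (rmorphM val)]. Qed.
HB.instance Definition _ :=
  GRing.isLinear.Build K subalg A *:%R subalg_val subalg_val_linear.
HB.instance Definition _ :=
  GRing.isMonoidMorphism.Build subalg A subalg_val subalg_val_monoid.
Definition subalg_incl : {lrmorphism subalg -> A} := subalg_val.

Lemma subalg_incl_inj : injective subalg_incl.
Proof. exact: val_inj. Qed.

Lemma mem_subalg a : S a -> a \in gen_subalg.
Proof. by move=> Sa; apply/asboolP/sub_gen. Qed.

Definition subalg_gen a (Sa : S a) : subalg := exist _ a (mem_subalg Sa).

End GeneratedSubalgebra.

Section TensorMapAlg.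
Variables (K : fieldType) (A A' B B' : algType K).
Variables (f : {lrmorphism A -> A'}) (g : {lrmorphism B -> B'}).

Lemma tensor_map1 : tensor_map f g 1 = 1.
Proof. by rewrite tensor1E tensor_mapE !rmorph1. Qed.
Lemma tensor_mapM : {morph tensor_map f g : s t / s * t}.
Proof.
move=> s t; elim/tensor_ind: s => [a b|s s' IHs IHs']; last first.
  by rewrite mulrDl !linearD /= IHs IHs' mulrDl.
elim/tensor_ind: t => [a' b'|t t' IHt IHt']; last first.
  by rewrite mulrDr !linearD /= IHt IHt' mulrDr.
by rewrite tensorM !tensor_mapE tensorM !rmorphM.
Qed.

End TensorMapAlg.

(* C(q), with C = R[i] for a model R of the real numbers. *)
Definition Cq (R : realType) : fieldType := {fraction {poly R[i]%C}}.
Definition qvar (R : realType) : Cq R := tofrac 'X.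

Section GroundField.
Variable R : realType.
Notation q := (qvar R).

Lemma qvar_neq0 : q != 0.
Proof. by rewrite /qvar tofrac_eq0 polyX_eq0. Qed.

Lemma qvar_sq : q ^+ 2 != 1.
Proof.
rewrite /qvar -tofracXn -tofrac1 tofrac_eq; apply/eqP => /(congr1 (fun p : {poly _} => size p)).
by rewrite size_polyXn size_poly1.
Qed.

Lemma qvar_subV : q - q^-1 != 0.
Proof.
have := qvar_sq; apply: contra; rewrite subr_eq0 => /eqP qq.
by rewrite expr2 {2}qq divff // qvar_neq0.
Qed.

Definition qint (n : int) : Cq R := (q ^ n - q ^ (- n)) / (q - q^-1).

End GroundField.

Inductive gl2_gen := genE | genF | genD1 | genD1V | genD2 | genD2V.

(* The defining relations of U_q(gl_2), for a family e of elements of an algebra. *)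
Record gl2_relations (K : fieldType) (q : K) (A : algType K) (e : gl2_gen -> A) :
    Prop := Gl2Relations {
  relD1K : e genD1 * e genD1V = 1;
  relD1VK : e genD1V * e genD1 = 1;
  relD2K : e genD2 * e genD2V = 1;
  relD2VK : e genD2V * e genD2 = 1;
  relDC : e genD1 * e genD2 = e genD2 * e genD1;
  relD1E : e genD1 * e genE * e genD1V = q *: e genE;
  relD2E : e genD2 * e genE * e genD2V = q^-1 *: e genE;
  relD1F : e genD1 * e genF * e genD1V = q^-1 *: e genF;
  relD2F : e genD2 * e genF * e genD2V = q *: e genF;
  relEF : e genE * e genF - e genF * e genE =
    (q - q^-1)^-1 *: (e genD1 * e genD2V - e genD2 * e genD1V)
}.

Section QuantumGroup.
Variable R : realType.
Notation K := (Cq R).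
Notation q := (qvar R).

Inductive uq_term : Type :=
| UGen of gl2_gen
| UOne
| UAdd of uq_term & uq_term
| UMul of uq_term & uq_term
| UScale of K & uq_term.

Declare Scope uq_scope.
Local Notation "s + t" := (UAdd s t) : uq_scope.
Local Notation "s * t" := (UMul s t) : uq_scope.
Local Notation "c *: s" := (UScale c s) : uq_scope.
Local Notation "s - t" := (UAdd s (UScale (-1) t)) : uq_scope.
Delimit Scope uq_scope with uq.
Local Coercion UGen : gl2_gen >-> uq_term.

Inductive uq_rel : uq_term -> uq_term -> Prop :=
| uqD1K : uq_rel (genD1 * genD1V)%uq UOne
| uqD1VK : uq_rel (genD1V * genD1)%uq UOne
| uqD2K : uq_rel (genD2 * genD2V)%uq UOne
| uqD2VK : uq_rel (genD2V * genD2)%uq UOne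
| uqDC : uq_rel (genD1 * genD2)%uq (genD2 * genD1)%uq
| uqD1E : uq_rel (genD1 * genE * genD1V)%uq (q *: genE)%uq
| uqD2E : uq_rel (genD2 * genE * genD2V)%uq (q^-1 *: genE)%uq
| uqD1F : uq_rel (genD1 * genF * genD1V)%uq (q^-1 *: genF)%uq
| uqD2F : uq_rel (genD2 * genF * genD2V)%uq (q *: genF)%uq
| uqEF : uq_rel (genE * genF - genF * genE)%uq
    ((q - q^-1)^-1 *: (genD1 * genD2V - genD2 * genD1V))%uq.

(* The congruence generated by the axioms of unital associative algebras and *)
(* the defining relations.                                                    *)
Inductive uq_eq : uq_term -> uq_term -> Prop :=
| ueq_rel s t : uq_rel s t -> uq_eq s t
| ueq_refl s : uq_eq s s
| ueq_sym s t : uq_eq s t -> uq_eq t s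
| ueq_trans s t u : uq_eq s t -> uq_eq t u -> uq_eq s u
| ueq_add s s' t t' : uq_eq s s' -> uq_eq t t' -> uq_eq (s + t)%uq (s' + t')%uq
| ueq_mul s s' t t' : uq_eq s s' -> uq_eq t t' -> uq_eq (s * t)%uq (s' * t')%uq
| ueq_scale c s s' : uq_eq s s' -> uq_eq (c *: s)%uq (c *: s')%uq
| ueq_addA s t u : uq_eq (s + (t + u))%uq (s + t + u)%uq
| ueq_addC s t : uq_eq (s + t)%uq (t + s)%uq
| ueq_add0 s : uq_eq (0 *: UOne + s)%uq s
| ueq_addN s : uq_eq ((-1) *: s + s)%uq (0 *: UOne)%uq
| ueq_mulA s t u : uq_eq (s * (t * u))%uq (s * t * u)%uq
| ueq_mul1l s : uq_eq (UOne * s)%uq s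
| ueq_mul1r s : uq_eq (s * UOne)%uq s
| ueq_mulDl s t u : uq_eq ((s + t) * u)%uq (s * u + t * u)%uq
| ueq_mulDr s t u : uq_eq (s * (t + u))%uq (s * t + s * u)%uq
| ueq_scaleA c d s : uq_eq (c *: (d *: s))%uq ((c * d)%R *: s)%uq
| ueq_scale1 s : uq_eq (1 *: s)%uq s
| ueq_scaleDr c s t : uq_eq (c *: (s + t))%uq (c *: s + c *: t)%uq
| ueq_scaleDl c d s : uq_eq ((c + d)%R *: s)%uq (c *: s + d *: s)%uq
| ueq_scaleAl c s t : uq_eq (c *: (s * t))%uq ((c *: s) * t)%uq
| ueq_scaleAr c s t : uq_eq (c *: (s * t))%uq (s * (c *: t))%uq.

HB.instance Definition _ := gen_eqMixin uq_term.
HB.instance Definition _ := gen_choiceMixin uq_term.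

Definition uq_eqb : rel uq_term := fun s t => `[< uq_eq s t >].

Lemma uq_eqb_equiv : equiv_class_of uq_eqb.
Proof.
split=> [s|s t|t s u]; first exact/asboolP/ueq_refl.
  by apply/asboolP/asboolP; apply: ueq_sym.
by move=> /asboolP ? /asboolP ?; apply/asboolP/(@ueq_trans _ t).
Qed.
Canonical uq_equiv := EquivRelPack uq_eqb_equiv.

Definition Uq : Type := {eq_quot uq_equiv}.
HB.instance Definition _ := Choice.on Uq.
HB.instance Definition _ : EqQuotient _ uq_equiv Uq := EqQuotient.on Uq.

Definition uq_zero : Uq := \pi_Uq (0 *: UOne)%uq.
Definition uq_one : Uq := \pi_Uq UOne.
Definition uq_add (x y : Uq) : Uq := \pi_Uq (repr x + repr y)%uq.
Definition uq_opp (x : Uq) : Uq := \pi_Uq ((-1) *: repr x)%uq.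
Definition uq_mul (x y : Uq) : Uq := \pi_Uq (repr x * repr y)%uq.
Definition uq_scale c (x : Uq) : Uq := \pi_Uq (c *: repr x)%uq.

Lemma uq_piE s t : uq_eq s t -> \pi_Uq s = \pi_Uq t.
Proof. by move=> st; apply/(@eqquotP _ _ Uq)/asboolP. Qed.
Lemma uq_reprP s : uq_eq (repr (\pi_Uq s)) s.
Proof. by apply/asboolP; apply/(@eqquotP _ _ Uq); rewrite reprK. Qed.

Lemma pi_uq_add s t : uq_add (\pi_Uq s) (\pi_Uq t) = \pi_Uq (s + t)%uq.
Proof. by apply: uq_piE; apply: ueq_add; apply: uq_reprP. Qed.
Lemma pi_uq_opp s : uq_opp (\pi_Uq s) = \pi_Uq ((-1) *: s)%uq.
Proof. by apply: uq_piE; apply: ueq_scale; apply: uq_reprP. Qed.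
Lemma pi_uq_mul s t : uq_mul (\pi_Uq s) (\pi_Uq t) = \pi_Uq (s * t)%uq.
Proof. by apply: uq_piE; apply: ueq_mul; apply: uq_reprP. Qed.
Lemma pi_uq_scale c s : uq_scale c (\pi_Uq s) = \pi_Uq (c *: s)%uq.
Proof. by apply: uq_piE; apply: ueq_scale; apply: uq_reprP. Qed.

Fact uq_addA : associative uq_add.
Proof.
elim/quotW=> s; elim/quotW=> t; elim/quotW=> u.
rewrite (pi_uq_add t u) (pi_uq_add s) (pi_uq_add s t) (pi_uq_add _ u).
exact/uq_piE/ueq_addA.
Qed.
Fact uq_addC : commutative uq_add.
Proof.
elim/quotW=> s; elim/quotW=> t; rewrite (pi_uq_add s t) (pi_uq_add t s).
exact/uq_piE/ueq_addC.
Qed.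
Fact uq_add0 : left_id uq_zero uq_add.
Proof. by elim/quotW=> s; rewrite (pi_uq_add _ s); exact/uq_piE/ueq_add0. Qed.
Fact uq_addN : left_inverse uq_zero uq_opp uq_add.
Proof.
by elim/quotW=> s; rewrite (pi_uq_opp s) (pi_uq_add _ s); exact/uq_piE/ueq_addN.
Qed.
HB.instance Definition _ := GRing.isZmodule.Build Uq uq_addA uq_addC uq_add0 uq_addN.

Fact uq_mulA : associative uq_mul.
Proof.
elim/quotW=> s; elim/quotW=> t; elim/quotW=> u.
rewrite (pi_uq_mul t u) (pi_uq_mul s) (pi_uq_mul s t) (pi_uq_mul _ u).
exact/uq_piE/ueq_mulA.
Qed.
Fact uq_mul1l : left_id uq_one uq_mul.
Proof. by elim/quotW=> s; rewrite (pi_uq_mul _ s); exact/uq_piE/ueq_mul1l. Qed.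
Fact uq_mul1r : right_id uq_one uq_mul.
Proof. by elim/quotW=> s; rewrite (pi_uq_mul s); exact/uq_piE/ueq_mul1r. Qed.
Fact uq_mulDl : left_distributive uq_mul +%R.
Proof.
elim/quotW=> s; elim/quotW=> t; elim/quotW=> u; rewrite /GRing.add /= (pi_uq_add s t).
rewrite !(pi_uq_mul _ u) (pi_uq_add (s * u)%uq).
exact/uq_piE/ueq_mulDl.
Qed.
Fact uq_mulDr : right_distributive uq_mul +%R.
Proof.
elim/quotW=> s; elim/quotW=> t; elim/quotW=> u; rewrite /GRing.add /= (pi_uq_add t u).
rewrite !(pi_uq_mul s) (pi_uq_add (s * t)%uq).
exact/uq_piE/ueq_mulDr.
Qed.

Fact uq_scaleA a b x : uq_scale a (uq_scale b x) = uq_scale (a * b) x.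
Proof.
elim/quotW: x => s; rewrite (pi_uq_scale b s) !(pi_uq_scale _ _).
exact/uq_piE/ueq_scaleA.
Qed.
Fact uq_scale1 : left_id 1 uq_scale.
Proof. by elim/quotW=> s; rewrite (pi_uq_scale _ s); exact/uq_piE/ueq_scale1. Qed.
Fact uq_scaleDr : right_distributive uq_scale +%R.
Proof.
move=> a; elim/quotW=> s; elim/quotW=> t; rewrite /GRing.add /= (pi_uq_add s t).
rewrite !(pi_uq_scale a) (pi_uq_add (a *: s)%uq).
exact/uq_piE/ueq_scaleDr.
Qed.
Fact uq_scaleDl x : {morph uq_scale^~ x : a b / a + b}.
Proof.
elim/quotW: x => s a b; rewrite [in RHS]/GRing.add /= !(pi_uq_scale _ s).
rewrite (pi_uq_add (a *: s)%uq).
exact/uq_piE/ueq_scaleDl.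
Qed.
HB.instance Definition _ := GRing.Zmodule_isLmodule.Build K Uq
  uq_scaleA uq_scale1 uq_scaleDr uq_scaleDl.

Section Eval.
Variables (A : algType K) (e : gl2_gen -> A).
Hypothesis eP : gl2_relations q e.

Fixpoint uq_eval (s : uq_term) : A :=
  match s with
  | UGen g => e g
  | UOne => 1
  | UAdd s t => uq_eval s + uq_eval t
  | UMul s t => uq_eval s * uq_eval t
  | UScale c s => c *: uq_eval s
  end.

Lemma uq_evalP s t : uq_eq s t -> uq_eval s = uq_eval t.
Proof.
elim=> //=.
- move=> {}s {}t [] /=; rewrite ?scaleN1r; by case: eP.
- by move=> ? ? ? _ -> _ ->.
- by move=> ? ? ? ? _ -> _ ->.
- by move=> ? ? ? ? _ -> _ ->.
- by move=> ? ? ? _ ->.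
- by move=> *; rewrite addrA.
- by move=> *; rewrite addrC.
- by move=> *; rewrite scale0r add0r.
- by move=> *; rewrite scaleN1r addNr scale0r.
- by move=> *; rewrite mulrA.
- by move=> *; rewrite mul1r.
- by move=> *; rewrite mulr1.
- by move=> *; rewrite mulrDl.
- by move=> *; rewrite mulrDr.
- by move=> *; rewrite scalerA.
- by move=> *; rewrite scale1r.
- by move=> *; rewrite scalerDr.
- by move=> *; rewrite scalerDl.
- by move=> *; rewrite scalerAl.
- by move=> *; rewrite scalerAr.
Qed.

Definition uq_lift_fun (x : Uq) : A := uq_eval (repr x).

Lemma uq_lift_pi s : uq_lift_fun (\pi_Uq s) = uq_eval s.
Proof. exact/uq_evalP/uq_reprP. Qed.

End Eval.

End QuantumGroup.
Section StandardMatrices.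
Variables (K : fieldType) (q : K).

(* The matrices of the generators on the basis x, y of the standard representation. *)
Definition std_mx (g : gl2_gen) : 'M[K]_2 :=
  match g with
  | genE => delta_mx 0 1
  | genF => delta_mx 1 0
  | genD1 => q *: delta_mx 0 0 + delta_mx 1 1
  | genD1V => q^-1 *: delta_mx 0 0 + delta_mx 1 1
  | genD2 => delta_mx 0 0 + q *: delta_mx 1 1
  | genD2V => delta_mx 0 0 + q^-1 *: delta_mx 1 1
  end.

Fact std_mx_relations : q != 0 -> q - q^-1 != 0 -> gl2_relations q std_mx.
Proof.
move=> q0 qV.
have one : (1 : 'M[K]_2) = delta_mx 0 0 + delta_mx 1 1.
  rewrite -[LHS]/(1%:M) mx1_sum_delta !big_ord_recl big_ord0 addr0.
  by congr (delta_mx _ _ + delta_mx _ _); apply/val_inj.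
have mE (i j k l : 'I_2) :
    (delta_mx i j : 'M[K]_2) * delta_mx k l = if j == k then delta_mx i l else 0.
  rewrite -[LHS]/(_ *m _) mul_delta_mx_cond; by case: eqP.
pose r := (mulrDl, mulrDr, =^~ scalerAl, =^~ scalerAr, mE, addr0, add0r, scaler0,
  mul0r, mulr0, scalerA, mulfV q0, mulVf q0, scale1r).
split; rewrite /= ?r //= ?r //= ?r //= ?one //.
set a := delta_mx 0 0; set b := delta_mx 1 1.
rewrite opprD addrACA -!scalerBl -[q^-1 - q]opprB scaleNr -scalerBr scalerA.
by rewrite mulVf // scale1r.
Qed.

End StandardMatrices.
Section ComultRelations.
Variables (K : fieldType) (q : K) (A : algType K) (e : gl2_gen -> A).
Hypotheses (q0 : q != 0) (eP : gl2_relations q e).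

Local Notation E := (e genE).
Local Notation F := (e genF).
Local Notation D1 := (e genD1).
Local Notation D1V := (e genD1V).
Local Notation D2 := (e genD2).
Local Notation D2V := (e genD2V).
Local Notation Kp := (D1 * D2V).
Local Notation Km := (D2 * D1V).

Lemma gl2_D1E : D1 * E = q *: (E * D1).
Proof. by rewrite scalerAl -(relD1E eP) -[RHS]mulrA (relD1VK eP) mulr1. Qed.
Lemma gl2_D2E : D2 * E = q^-1 *: (E * D2).
Proof. by rewrite scalerAl -(relD2E eP) -[RHS]mulrA (relD2VK eP) mulr1. Qed.
Lemma gl2_D1F : D1 * F = q^-1 *: (F * D1).
Proof. by rewrite scalerAl -(relD1F eP) -[RHS]mulrA (relD1VK eP) mulr1. Qed.
Lemma gl2_D2F : D2 * F = q *: (F * D2).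
Proof. by rewrite scalerAl -(relD2F eP) -[RHS]mulrA (relD2VK eP) mulr1. Qed.

Lemma gl2_inv_comm (d dV x : A) (c : K) : c != 0 -> d * dV = 1 -> dV * d = 1 ->
  d * x = c *: (x * d) -> dV * x = c^-1 *: (x * dV).
Proof.
move=> c0 dK dVK dx; have -> : x * dV = c *: (dV * x).
  rewrite -[in LHS](mul1r x) -{1}dVK -(mulrA dV) dx -scalerAr -scalerAl.
  by rewrite -!mulrA dK mulr1.
by rewrite scalerA mulVf // scale1r.
Qed.

Lemma gl2_D1VE : D1V * E = q^-1 *: (E * D1V).
Proof. exact: (gl2_inv_comm q0 (relD1K eP) (relD1VK eP) gl2_D1E). Qed.
Lemma gl2_D2VE : D2V * E = q *: (E * D2V).
Proof.
have := gl2_inv_comm _ (relD2K eP) (relD2VK eP) gl2_D2E.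
by rewrite invrK invr_eq0; apply.
Qed.
Lemma gl2_D1VF : D1V * F = q *: (F * D1V).
Proof.
have := gl2_inv_comm _ (relD1K eP) (relD1VK eP) gl2_D1F.
by rewrite invrK invr_eq0; apply.
Qed.
Lemma gl2_D2VF : D2V * F = q^-1 *: (F * D2V).
Proof. exact: (gl2_inv_comm q0 (relD2K eP) (relD2VK eP) gl2_D2F). Qed.

Lemma gl2_inv_comm1 (d dV x : A) : d * dV = 1 -> dV * d = 1 ->
  d * x = x * d -> dV * x = x * dV.
Proof.
move=> dK dVK dx; have := @gl2_inv_comm d dV x 1 (oner_neq0 _) dK dVK.
by rewrite dx invr1 !scale1r; apply.
Qed.

Lemma gl2_D2VD1 : D2V * D1 = D1 * D2V.
Proof. by apply: (gl2_inv_comm1 (relD2K eP) (relD2VK eP)); rewrite (relDC eP). Qed.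
Lemma gl2_D1VD2 : D1V * D2 = D2 * D1V.
Proof. by apply: (gl2_inv_comm1 (relD1K eP) (relD1VK eP)); rewrite (relDC eP). Qed.
Lemma gl2_D1VD2V : D1V * D2V = D2V * D1V.
Proof. by apply: (gl2_inv_comm1 (relD1K eP) (relD1VK eP)); rewrite gl2_D2VD1. Qed.

Lemma gl2_KF : Kp * F = q^-1 ^+ 2 *: (F * Kp).
Proof.
by rewrite -mulrA gl2_D2VF -scalerAr [D1 * (_ * _)]mulrA gl2_D1F -scalerAl -[F * D1 * _]mulrA scalerA.
Qed.
Lemma gl2_KmE : Km * E = q^-1 ^+ 2 *: (E * Km).
Proof.
by rewrite -mulrA gl2_D1VE -scalerAr [D2 * (_ * _)]mulrA gl2_D2E -scalerAl -[E * D2 * _]mulrA scalerA.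
Qed.
Lemma gl2_KK : Kp * Km = 1.
Proof. by rewrite mulrA -(mulrA D1) (relD2VK eP) mulr1 (relD1K eP). Qed.
Lemma gl2_KmK : Km * Kp = 1.
Proof. by rewrite mulrA -(mulrA D2) (relD1VK eP) mulr1 (relD2K eP). Qed.

Definition comult_gen (g : gl2_gen) : tensor A A :=
  match g with
  | genE => E ⊗ 1 + Kp ⊗ E
  | genF => F ⊗ Km + 1 ⊗ F
  | _ => e g ⊗ e g
  end.

Fact comult_relations : gl2_relations q comult_gen.
Proof.
have conjKp d dV : d * dV = 1 -> d * D1 = D1 * d -> d * D2V = D2V * d ->
    d * Kp * dV = Kp.
  by move=> dK d1 d2; rewrite mulrA d1 -(mulrA D1) d2 mulrA -[LHS]mulrA dK mulr1.
have conjKm d dV : d * dV = 1 -> d * D2 = D2 * d -> d * D1V = D1V * d ->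
    d * Km * dV = Km.
  by move=> dK d2 d1; rewrite mulrA d2 -(mulrA D2) d1 mulrA -[LHS]mulrA dK mulr1.
have cj (d dV x y x' y' : A) :
    ((d ⊗ d) * (x ⊗ y + x' ⊗ y') * (dV ⊗ dV) : tensor A A) =
    (d * x * dV) ⊗ (d * y * dV) + (d * x' * dV) ⊗ (d * y' * dV).
  by rewrite mulrDr mulrDl !tensorM.
have EF : (E ⊗ 1 + Kp ⊗ E) * (F ⊗ Km + 1 ⊗ F) - (F ⊗ Km + 1 ⊗ F) * (E ⊗ 1 + Kp ⊗ E) =
    (E * F - F * E) ⊗ Km + Kp ⊗ (E * F - F * E) :> tensor A A.
  rewrite !(mulrDl, mulrDr) !tensorM !(mulr1, mul1r) gl2_KF gl2_KmE.
  rewrite pure_tensorZl pure_tensorZr -!scaleN1r !(pure_tensorDl, pure_tensorDr).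
  rewrite !(pure_tensorZl, pure_tensorZr) !scaleN1r.
  set X := _ *: _; set Y := E ⊗ F.
  set a := (E * F) ⊗ Km; set b := Kp ⊗ (E * F); set c := (F * E) ⊗ Km.
  set d := Kp ⊗ (F * E).
  rewrite !opprD -!addrA; congr (_ + _).
  by rewrite (addrCA b) (addrCA X) (addrCA Y) (addrCA b) addNKr (addrCA b) addNKr.
split=> /=.
- by rewrite tensorM (relD1K eP).
- by rewrite tensorM (relD1VK eP).
- by rewrite tensorM (relD2K eP).
- by rewrite tensorM (relD2VK eP).
- by rewrite !tensorM (relDC eP).
- refine (etrans (cj D1 D1V E 1 Kp E) _); rewrite mulr1 (relD1K eP) (relD1E eP) conjKp ?(relD1K eP) ?(relD1VK eP) //.
    by rewrite scalerDr pure_tensorZl pure_tensorZr.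
  by rewrite gl2_D2VD1.
- refine (etrans (cj D2 D2V E 1 Kp E) _); rewrite mulr1 (relD2K eP) (relD2E eP) conjKp ?(relD2K eP) ?(relD2VK eP) //.
    by rewrite scalerDr pure_tensorZl pure_tensorZr.
  by rewrite (relDC eP).
- refine (etrans (cj D1 D1V F Km 1 F) _); rewrite mulr1 (relD1K eP) (relD1F eP) conjKm ?(relD1K eP) ?(relD1VK eP) //.
    by rewrite scalerDr pure_tensorZl pure_tensorZr.
  by rewrite (relDC eP).
- refine (etrans (cj D2 D2V F Km 1 F) _); rewrite mulr1 (relD2K eP) (relD2F eP) conjKm ?(relD2K eP) ?(relD2VK eP) //.
    by rewrite scalerDr pure_tensorZl pure_tensorZr.
  by rewrite gl2_D1VD2.
refine (etrans EF _); rewrite (relEF eP) pure_tensorZl pure_tensorZr -scalerDr.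
congr (_ *: _); rewrite !tensorM.
have -> : (Kp - Km) ⊗ Km = Kp ⊗ Km - Km ⊗ Km.
  by rewrite pure_tensorDl -scaleN1r pure_tensorZl scaleN1r.
have -> : Kp ⊗ (Kp - Km) = Kp ⊗ Kp - Kp ⊗ Km.
  by rewrite pure_tensorDr -scaleN1r pure_tensorZr scaleN1r.
by rewrite addrC addrA subrK.
Qed.

End ComultRelations.
Section UqAlgebra.
Variable R : realType.
Notation K := (Cq R).
Notation q := (qvar R).
Notation Uq := (Uq R).

Fact uq_one_neq0 : uq_one R != 0.
Proof.
apply/eqP => /(congr1 (uq_lift_fun (std_mx q))).
rewrite !(uq_lift_pi (std_mx_relations (qvar_neq0 R) (qvar_subV R))) /= scale0r.
by apply/eqP; exact: oner_neq0.
Qed.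

HB.instance Definition _ := GRing.Zmodule_isNzRing.Build Uq (@uq_mulA R)
  (@uq_mul1l R) (@uq_mul1r R) (@uq_mulDl R) (@uq_mulDr R) uq_one_neq0.

Fact uq_scaleAl (c : K) (x y : Uq) : c *: (x * y) = (c *: x) * y.
Proof.
elim/quotW: x => s; elim/quotW: y => t; rewrite /GRing.mul /GRing.scale /=.
rewrite (pi_uq_mul s t) !(pi_uq_scale c) (pi_uq_mul (UScale c s)).
exact/uq_piE/ueq_scaleAl.
Qed.
HB.instance Definition _ := GRing.Lmodule_isLalgebra.Build K Uq uq_scaleAl.
Fact uq_scaleAr (c : K) (x y : Uq) : c *: (x * y) = x * (c *: y).
Proof.
elim/quotW: x => s; elim/quotW: y => t; rewrite /GRing.mul /GRing.scale /=.
rewrite (pi_uq_mul s t) !(pi_uq_scale c) (pi_uq_mul s (UScale c t)).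
exact/uq_piE/ueq_scaleAr.
Qed.
HB.instance Definition _ := GRing.Lalgebra_isAlgebra.Build K Uq uq_scaleAr.

Lemma pi_uqD s t : \pi_Uq (UAdd s t) = \pi_Uq s + \pi_Uq t.
Proof. by rewrite [RHS]pi_uq_add. Qed.
Lemma pi_uqM s t : \pi_Uq (UMul s t) = \pi_Uq s * \pi_Uq t.
Proof. by rewrite [RHS]pi_uq_mul. Qed.
Lemma pi_uqZ c s : \pi_Uq (UScale c s) = c *: \pi_Uq s.
Proof. by rewrite [RHS]pi_uq_scale. Qed.
Lemma pi_uq1 : \pi_Uq (UOne R) = 1. Proof. by []. Qed.

Definition uq_gen (g : gl2_gen) : Uq := \pi_Uq (UGen R g).

Lemma uq_gen_relations : gl2_relations q uq_gen.
Proof.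
have E s t : uq_rel s t -> \pi_Uq s = \pi_Uq t by move/ueq_rel/uq_piE.
split.
- by have := E _ _ (@uqD1K R); rewrite !(pi_uqM, pi_uqZ, pi_uqD) ?scaleN1r.
- by have := E _ _ (@uqD1VK R); rewrite !(pi_uqM, pi_uqZ, pi_uqD) ?scaleN1r.
- by have := E _ _ (@uqD2K R); rewrite !(pi_uqM, pi_uqZ, pi_uqD) ?scaleN1r.
- by have := E _ _ (@uqD2VK R); rewrite !(pi_uqM, pi_uqZ, pi_uqD) ?scaleN1r.
- by have := E _ _ (@uqDC R); rewrite !(pi_uqM, pi_uqZ, pi_uqD) ?scaleN1r.
- by have := E _ _ (@uqD1E R); rewrite !(pi_uqM, pi_uqZ, pi_uqD) ?scaleN1r.
- by have := E _ _ (@uqD2E R); rewrite !(pi_uqM, pi_uqZ, pi_uqD) ?scaleN1r.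
- by have := E _ _ (@uqD1F R); rewrite !(pi_uqM, pi_uqZ, pi_uqD) ?scaleN1r.
- by have := E _ _ (@uqD2F R); rewrite !(pi_uqM, pi_uqZ, pi_uqD) ?scaleN1r.
- by have := E _ _ (@uqEF R); rewrite !(pi_uqM, pi_uqZ, pi_uqD) ?scaleN1r.
Qed.

Lemma uq_ind (P : Uq -> Prop) :
  (forall g, P (uq_gen g)) -> P 1 -> (forall x y, P x -> P y -> P (x + y)) ->
  (forall x y, P x -> P y -> P (x * y)) -> (forall c x, P x -> P (c *: x)) ->
  forall x, P x.
Proof.
move=> Pg P1 PD PM PZ; elim/quotW; elim=> [g||s ? t ?|s ? t ?|c s ?].
- exact: Pg.
- exact: P1.
- by rewrite pi_uqD; apply: PD.
- by rewrite pi_uqM; apply: PM.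
- by rewrite pi_uqZ; apply: PZ.
Qed.

Section Lift.
Variables (A : algType K) (e : gl2_gen -> A) (eP : gl2_relations q e).

Fact uq_lift_linear : linear (uq_lift_fun e).
Proof.
by move=> c; elim/quotW=> s; elim/quotW=> t; rewrite -pi_uqZ -pi_uqD !(uq_lift_pi eP).
Qed.
Fact uq_lift_monoid : monoid_morphism (uq_lift_fun e).
Proof.
split; first by rewrite -pi_uq1 (uq_lift_pi eP).
by elim/quotW=> s; elim/quotW=> t; rewrite -pi_uqM !(uq_lift_pi eP).
Qed.

Definition uq_lift : {lrmorphism Uq -> A} :=
  HB.pack (uq_lift_fun e)
    (GRing.isLinear.Build K Uq A *:%R (uq_lift_fun e) uq_lift_linear)
    (GRing.isMonoidMorphism.Build Uq A (uq_lift_fun e) uq_lift_monoid).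

Lemma uq_lift_gen g : uq_lift (uq_gen g) = e g.
Proof. by rewrite /= (uq_lift_pi eP). Qed.

End Lift.

Definition uE : Uq := uq_gen genE.
Definition uF : Uq := uq_gen genF.
Definition uD1 : Uq := uq_gen genD1.
Definition uD1V : Uq := uq_gen genD1V.
Definition uD2 : Uq := uq_gen genD2.
Definition uD2V : Uq := uq_gen genD2V.
Definition uK : Uq := uD1 * uD2V.
Definition uKV : Uq := uD2 * uD1V.

Definition Delta : {lrmorphism Uq -> tensor Uq Uq} :=
  uq_lift (comult_relations (qvar_neq0 R) uq_gen_relations).

Lemma DeltaM : {morph Delta : a b / a * b}.
Proof. exact: rmorphM. Qed.
Lemma DeltaE : Delta uE = uE ⊗ 1 + uK ⊗ uE.
Proof. exact: uq_lift_gen. Qed.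
Lemma DeltaF : Delta uF = uF ⊗ uKV + 1 ⊗ uF.
Proof. exact: uq_lift_gen. Qed.
Lemma DeltaD1 : Delta uD1 = uD1 ⊗ uD1.
Proof. exact: uq_lift_gen. Qed.
Lemma DeltaD1V : Delta uD1V = uD1V ⊗ uD1V.
Proof. exact: uq_lift_gen. Qed.
Lemma DeltaD2 : Delta uD2 = uD2 ⊗ uD2.
Proof. exact: uq_lift_gen. Qed.
Lemma DeltaD2V : Delta uD2V = uD2V ⊗ uD2V.
Proof. exact: uq_lift_gen. Qed.
Lemma DeltaKV : Delta uKV = uKV ⊗ uKV.
Proof. by rewrite DeltaM DeltaD2 DeltaD1V tensorM. Qed.

Lemma uKVK : uKV * uK = 1.
Proof. exact: (gl2_KmK uq_gen_relations). Qed.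
Lemma uKKV : uK * uKV = 1.
Proof. exact: (gl2_KK uq_gen_relations). Qed.

(* The standard representation: column vectors, with x and y the unit vectors. *)
Definition std_hom : {lrmorphism Uq -> 'M[K]_2} :=
  uq_lift (std_mx_relations (qvar_neq0 R) (qvar_subV R)).

Definition std_act (u : Uq) : {linear 'cV[K]_2 -> 'cV[K]_2} := mulmx (std_hom u).
Fact std_act_linear v : linear (fun u => std_act u v).
Proof. by move=> c a b; rewrite /std_act linearP /= mulmxDl scalemxAl. Qed.
Fact std_act1 v : std_act 1 v = v.
Proof. by rewrite /std_act rmorph1; exact: mul1mx. Qed.
Fact std_actM a b v : std_act (a * b) v = std_act a (std_act b v).
Proof. by rewrite /std_act rmorphM /= mulmxA. Qed.

Definition std : rep Uq := Rep std_act_linear std_act1 std_actM.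

Definition std_x : std := delta_mx 0 0 : 'cV[K]_2.
Definition std_y : std := delta_mx 1 0 : 'cV[K]_2.

Lemma std_genE g (v : std) : act (uq_gen g) v = std_mx q g *m (v : 'cV[K]_2).
Proof. by rewrite /= (uq_lift_pi (std_mx_relations (qvar_neq0 R) (qvar_subV R))). Qed.

Fact std_mx_xy g :
  (std_mx q g *m (delta_mx 0 0 : 'cV[K]_2), std_mx q g *m (delta_mx 1 0 : 'cV[K]_2)) =
  match g with
  | genE => (0, delta_mx 0 0)
  | genF => (delta_mx 1 0, 0)
  | genD1 => (q *: delta_mx 0 0, delta_mx 1 0)
  | genD1V => (q^-1 *: delta_mx 0 0, delta_mx 1 0)
  | genD2 => (delta_mx 0 0, q *: delta_mx 1 0)
  | genD2V => (delta_mx 0 0, q^-1 *: delta_mx 1 0)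
  end.
Proof.
by case: g; rewrite /= ?mulmxDl -?scalemxAl !mul_delta_mx_cond /= ?mulr1n ?mulr0n
  ?scaler0 ?addr0 ?add0r.
Qed.

Lemma std_gen_x g : act (uq_gen g) std_x = (std_mx q g *m delta_mx 0 0 : 'cV[K]_2).
Proof. exact: std_genE. Qed.
Lemma std_gen_y g : act (uq_gen g) std_y = (std_mx q g *m delta_mx 1 0 : 'cV[K]_2).
Proof. exact: std_genE. Qed.

Lemma std_Ex : act uE std_x = 0.
Proof. by rewrite std_gen_x; case: (std_mx_xy genE). Qed.
Lemma std_Ey : act uE std_y = std_x.
Proof. by rewrite std_gen_y; case: (std_mx_xy genE). Qed.
Lemma std_Fx : act uF std_x = std_y.
Proof. by rewrite std_gen_x; case: (std_mx_xy genF). Qed.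
Lemma std_Fy : act uF std_y = 0.
Proof. by rewrite std_gen_y; case: (std_mx_xy genF). Qed.
Lemma std_D1x : act uD1 std_x = q *: std_x.
Proof. by rewrite std_gen_x; case: (std_mx_xy genD1). Qed.
Lemma std_D1y : act uD1 std_y = std_y.
Proof. by rewrite std_gen_y; case: (std_mx_xy genD1). Qed.
Lemma std_D2x : act uD2 std_x = std_x.
Proof. by rewrite std_gen_x; case: (std_mx_xy genD2). Qed.
Lemma std_D2y : act uD2 std_y = q *: std_y.
Proof. by rewrite std_gen_y; case: (std_mx_xy genD2). Qed.

End UqAlgebra.
Arguments uq_gen {R} g.
Arguments uE {R}.
Arguments uF {R}.
Arguments uD1 {R}.
Arguments uD1V {R}.
Arguments uD2 {R}.
Arguments uD2V {R}.
Arguments uK {R}.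
Arguments uKV {R}.
Arguments Delta {R} : simpl never.
Arguments std_hom {R} : simpl never.

Section Coideal.
Variable R : realType.
Notation K := (Cq R).
Notation q := (qvar R).
Notation Uq := (Uq R).

(* D_1 D_2 and its inverse. *)
Definition uC : Uq := uD1 * uD2.
Definition uCV : Uq := uD2V * uD1V.
Definition uB : Uq := q^-1 *: (uE * uKV) + uF.

Lemma uCK : uC * uCV = 1.
Proof.
by rewrite mulrA -(mulrA uD1) (relD2K (uq_gen_relations R)) mulr1
  (relD1K (uq_gen_relations R)).
Qed.

Definition iota_gens : set Uq := [set u | [\/ u = uC, u = uCV | u = uB]].

Definition Uiota : algType K := subalg iota_gens.
Definition iota_incl : {lrmorphism Uiota -> Uq} := subalg_incl iota_gens.

Fact iota_genC : iota_gens uC. Proof. by constructor 1. Qed.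
Fact iota_genCV : iota_gens uCV. Proof. by constructor 2. Qed.
Fact iota_genB : iota_gens uB. Proof. by constructor 3. Qed.
Definition iC : Uiota := subalg_gen iota_genC.
Definition iCV : Uiota := subalg_gen iota_genCV.
Definition iB : Uiota := subalg_gen iota_genB.

Lemma DeltaC : Delta uC = uC ⊗ uC.
Proof. by rewrite DeltaM DeltaD1 DeltaD2 tensorM. Qed.
Lemma DeltaCV : Delta uCV = uCV ⊗ uCV.
Proof. by rewrite DeltaM DeltaD1V DeltaD2V tensorM. Qed.
Lemma DeltaB : Delta uB = uB ⊗ uKV + 1 ⊗ uB.
Proof.
have DD a b : Delta (a + b) = Delta a + Delta b by exact: linearD.
have DZ c a : Delta (c *: a) = c *: Delta a by exact: linearZ.
rewrite DD DZ DeltaM DeltaE DeltaKV DeltaF mulrDl !tensorM mul1r uKKV.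
rewrite pure_tensorDl pure_tensorDr pure_tensorZl pure_tensorZr scalerDr.
by rewrite -!addrA; congr (_ + _); rewrite addrCA.
Qed.

Definition iota_tensor : {linear tensor Uiota Uq -> tensor Uq Uq} :=
  tensor_map iota_incl (idfun : {lrmorphism Uq -> Uq}).

Lemma iota_tensor_inj : injective iota_tensor.
Proof. exact/tensor_map_injl/subalg_incl_inj. Qed.

Lemma iota_tensorE a b : iota_tensor (a ⊗ b) = iota_incl a ⊗ b.
Proof. exact: tensor_mapE. Qed.
Lemma iota_tensorD : {morph iota_tensor : s t / s + t}.
Proof. exact: linearD. Qed.

Lemma coideal (u : Uiota) : exists t, iota_tensor t = Delta (iota_incl u).
Proof.
have [/asboolP] : iota_incl u \in gen_subalg iota_gens by exact: (valP u).
move: (iota_incl u) => {}u.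
have tM (s t : tensor Uiota Uq) : iota_tensor (s * t) = iota_tensor s * iota_tensor t.
  exact: (tensor_mapM iota_incl idfun).
elim=> {u}.
- move=> _ [->|->|->].
  + by exists (iC ⊗ uC); rewrite iota_tensorE DeltaC.
  + by exists (iCV ⊗ uCV); rewrite iota_tensorE DeltaCV.
  + by exists (iB ⊗ uKV + 1 ⊗ uB); rewrite iota_tensorD !iota_tensorE DeltaB rmorph1.
- by exists 1; rewrite [LHS](tensor_map1 iota_incl idfun) rmorph1.
- by move=> a b _ [s sE] _ [t tE']; exists (s + t); rewrite !linearD sE tE'.
- by move=> a b _ [s sE] _ [t tE']; exists (s * t); rewrite tM sE tE' DeltaM.
- by move=> c a _ [s sE]; exists (c *: s); rewrite !linearZ /= sE.
Qed.

(* The corestriction of Delta to U^iota -> U^iota ⊗ U_q(gl_2). *)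
Definition Delta_iota_fun (u : Uiota) : tensor Uiota Uq := sval (cid (coideal u)).

Lemma Delta_iota_funP u : iota_tensor (Delta_iota_fun u) = Delta (iota_incl u).
Proof. exact: (svalP (cid (coideal u))). Qed.

Fact Delta_iota_linear : linear Delta_iota_fun.
Proof.
move=> c a b; apply: iota_tensor_inj.
by rewrite linearP !Delta_iota_funP !linearP.
Qed.
Fact Delta_iota_monoid : monoid_morphism Delta_iota_fun.
Proof.
split=> [|a b]; apply: iota_tensor_inj; rewrite Delta_iota_funP.
  by rewrite [RHS](tensor_map1 iota_incl idfun) !rmorph1.
rewrite [RHS](tensor_mapM iota_incl idfun).
have -> : iota_incl (a * b) = iota_incl a * iota_incl b by exact: rmorphM.
rewrite DeltaM; by congr (_ * _); rewrite -Delta_iota_funP.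
Qed.

Definition Delta_iota : {lrmorphism Uiota -> tensor Uiota Uq} :=
  HB.pack Delta_iota_fun
    (GRing.isLinear.Build K Uiota (tensor Uiota Uq) *:%R Delta_iota_fun Delta_iota_linear)
    (GRing.isMonoidMorphism.Build Uiota (tensor Uiota Uq) Delta_iota_fun Delta_iota_monoid).

Lemma Delta_iotaP u : iota_tensor (Delta_iota u) = Delta (iota_incl u).
Proof. exact: Delta_iota_funP. Qed.

Lemma Delta_iotaB : Delta_iota iB = iB ⊗ uKV + 1 ⊗ uB.
Proof.
apply: iota_tensor_inj; rewrite Delta_iotaP iota_tensorD !iota_tensorE DeltaB.
by congr (_ + _ ⊗ _); rewrite rmorph1.
Qed.
Lemma Delta_iotaC : Delta_iota iC = iC ⊗ uC.
Proof. by apply: iota_tensor_inj; rewrite Delta_iotaP iota_tensorE DeltaC. Qed.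

(* M ⊗ W for a U^iota-module M and a U_q(gl_2)-module W. *)
Definition coideal_tensor (M : rep Uiota) (W : rep Uq) : rep Uiota :=
  pullback Delta_iota (outer_tensor M W).

Definition uq_tensor (M N : rep Uq) : rep Uq := pullback Delta (outer_tensor M N).

Definition iota_restrict (W : rep Uq) : rep Uiota := pullback iota_incl W.

Lemma outer_restrict (M W : rep Uq) (t : tensor Uiota Uq) (x : tensor M W) :
  act (r := outer_tensor M W) (iota_tensor t) x =
  act (r := outer_tensor (iota_restrict M) W) t x.
Proof.
elim/tensor_ind: t => [a b|s t IHs IHt].
  by rewrite iota_tensorE /= /outer_fun !tensor_liftE.
rewrite iota_tensorD; have D B (N : rep B) (c d : B) (z : N) :
    act (c + d) z = act c z + act d z.
  by have := act_linear z 1 c d; rewrite !scale1r.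
by rewrite [LHS]D [RHS]D IHs IHt.
Qed.

(* For a U_q(gl_2)-module M both structures on M ⊗ W agree. *)
Lemma iota_restrict_tensor (M W : rep Uq) (u : Uiota) (x : tensor M W) :
  act (r := iota_restrict (uq_tensor M W)) u x =
  act (r := coideal_tensor (iota_restrict M) W) u x.
Proof. by rewrite -[RHS]outer_restrict Delta_iotaP. Qed.

Lemma act_iB_tensor (M : rep Uiota) (W : rep Uq) (z : M) (w : W) :
  act (r := coideal_tensor M W) iB (z ⊗ w) = act iB z ⊗ act uKV w + z ⊗ act uB w.
Proof.
have -> : act (r := coideal_tensor M W) iB (z ⊗ w) =
    outer_act (Delta_iota iB) (z ⊗ w) by [].
by rewrite Delta_iotaB outer_actD !outer_act_pure act1.
Qed.

(* V^{⊗ n} for n >= 1, bracketed to the left; the value at n = 0 is junk. *)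
Definition std_power (n : nat) : rep Uq := iter n.-1 (uq_tensor^~ (std R)) (std R).

Definition vvec (n : int) : std R := std_x R + q ^ n *: std_y R.
Definition wvec (n : int) : std R := std_x R - q ^ (- n) *: std_y R.

End Coideal.

Arguments iC {R}.
Arguments iCV {R}.
Arguments iB {R}.
Arguments Delta_iota {R} : simpl never.

Section Subrepresentations.
Variables (K : fieldType) (A : algType K) (M : rep A).

Record subrep := Subrep {
  subrep_set :> set M;
  subrep0 : subrep_set 0;
  subrepP : forall c x y, subrep_set x -> subrep_set y -> subrep_set (c *: x + y);
  subrep_act : forall a x, subrep_set x -> subrep_set (act a x)
}.

Section SubrepModule.
Variable S : subrep.

Definition subrep_pred : {pred M} := fun x => `[< subrep_set S x >].
Fact subrep_pred_closed : GRing.submod_closed subrep_pred.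
Proof.
split=> [|c x y /asboolP Sx /asboolP Sy]; apply/asboolP; first exact: subrep0.
exact: subrepP.
Qed.
HB.instance Definition _ := GRing.isSubmodClosed.Build K M subrep_pred subrep_pred_closed.

Definition subrep_carrier : Type := {x : M | x \in subrep_pred}.
HB.instance Definition _ := [isSub of subrep_carrier for @sval _ _].
HB.instance Definition _ := [Choice of subrep_carrier by <:].
HB.instance Definition _ := [SubChoice_isSubLmodule of subrep_carrier by <:].

Fact subrep_act_mem a (x : subrep_carrier) : act a (val x) \in subrep_pred.
Proof. by apply/asboolP/subrep_act/asboolP/(valP x). Qed.
Definition subrep_act_fun a (x : subrep_carrier) : subrep_carrier :=
  exist _ (act a (val x)) (subrep_act_mem a x).
Fact subrep_act_fun_linear a : linear (subrep_act_fun a).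
Proof. by move=> c x y; apply: val_inj; rewrite /= !linearP. Qed.
HB.instance Definition _ a := GRing.isLinear.Build K subrep_carrier subrep_carrier *:%R
  (subrep_act_fun a) (subrep_act_fun_linear a).
Definition subrep_act_lin a : {linear subrep_carrier -> subrep_carrier} :=
  subrep_act_fun a.
Fact subrep_act_linear x : linear (fun a => subrep_act_lin a x).
Proof. by move=> c a b; apply: val_inj; exact: act_linear. Qed.
Fact subrep_act1 x : subrep_act_lin 1 x = x.
Proof. by apply: val_inj; rewrite /= act1. Qed.
Fact subrep_actM a b x : subrep_act_lin (a * b) x = subrep_act_lin a (subrep_act_lin b x).
Proof. by apply: val_inj; rewrite /= actM. Qed.

Definition subrep_rep : rep A := Rep subrep_act_linear subrep_act1 subrep_actM.

End SubrepModule.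

Definition line (x : M) : set M := [set y | exists c : K, y = c *: x].

Definition one_dimensional : Prop := exists2 x : M, x != 0 & line x = setT.

Definition act_eigenvector (a : A) (c : K) (x : M) : Prop := x != 0 /\ act a x = c *: x.

Definition act_eigenspace (a : A) (c : K) : set M := [set x | act a x = c *: x].

(* M is the internal direct sum of the S i. *)
Definition direct_sum (I : finType) (S : I -> subrep) : Prop :=
  forall x : M, exists! f : {ffun I -> M}, (forall i, subrep_set (S i) (f i)) /\ x = \sum_i f i.

End Subrepresentations.

Arguments act_eigenvector {K A} M a c x.
Arguments act_eigenspace {K A} M a c.

(* L is the one-dimensional representation L([m]) of U^iota on which C acts by q^n *)
(* and B by [m].  As C and B generate U^iota, this fixes L up to isomorphism.       *)
Definition is_L (R : realType) (n : nat) (m : int) (L : rep (Uiota R)) : Prop :=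
  [/\ one_dimensional L,
      forall l : L, act iC l = qvar R ^+ n *: l &
      forall l : L, act iB l = qint R m *: l].

(* Main.v *)
(* On V the element B swaps x and y, and Delta(B) = B ⊗ K^-1 + 1 ⊗ B, so for z of
   B-eigenvalue [n] the vector z ⊗ (x + t y) is an eigenvector exactly when
   [n] q^-1 + t = l and [n] q t + 1 = l t; the two solutions are t = q^n with
   l = [n+1] and t = -q^-n with l = [n-1].  Since q^n + q^-n <> 0, these two
   choices give a basis (v_n, w_n) of V for every n, so tensoring each vector of
   an eigenbasis of V^(⊗ n) with the matching pair gives an eigenbasis of
   V^(⊗ n+1), and Pascal's rule counts the eigenvalues. *)
From HB Require Import structures.
Require Import Defs.
From mathcomp Require Import all_boot all_order all_algebra.
From mathcomp Require Import boolp classical_sets reals complex.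
From mathcomp Require Import ring.
Set Implicit Arguments.
Unset Strict Implicit.
Unset Printing Implicit Defensive.
Import GRing.Theory Num.Theory.
Local Open Scope ring_scope.

(** * Bases with coordinate functionals, and their tensor products *)

Section DualBasis.
Variable K : fieldType.

(** Carrying the coordinate functionals along replaces independence and dimension counts: a
    coefficient is read off by applying [d i]. *)
Definition dual_basis (M : lmodType K) (I : finType) (b : I -> M)
    (d : I -> {linear M -> K^o}) : Prop :=
  (forall i j, d i (b j) = (i == j)%:R) /\ (forall x, x = \sum_i d i x *: b i).

Lemma dual_basis_neq0 (M : lmodType K) (I : finType) (b : I -> M) d i :
  dual_basis b d -> b i != 0.
Proof.
move=> [dE _]; apply/eqP => b0; have := dE i i.
by rewrite b0 linear0 eqxx => /esym/eqP; rewrite oner_eq0.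
Qed.

Lemma dual_basis_reindex (M : lmodType K) (I J : finType) (h : J -> I) (b : I -> M) d :
  bijective h -> dual_basis b d -> dual_basis (fun j => b (h j)) (fun j => d (h j)).
Proof.
move=> hbij [dE dS]; split=> [i j|x]; first by rewrite dE (inj_eq (bij_inj hbij)).
by rewrite [LHS]dS (reindex h) //; apply: onW_bij.
Qed.

Section Tensor.
Variables (M N : lmodType K) (I J : finType).
Variables (b : I -> M) (d : I -> {linear M -> K^o}).
Variables (c : I -> J -> N) (e : I -> J -> {linear N -> K^o}).

Fact tensor_dual_linl (p : I * J) n : linear (fun m => d p.1 m *: e p.1 p.2 n).
Proof. by move=> a m m'; rewrite linearP scalerDl scalerA. Qed.
Fact tensor_dual_linr (p : I * J) m : linear (fun n => d p.1 m *: e p.1 p.2 n).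
Proof. by move=> a n n'; rewrite linearP scalerDr !scalerA mulrC. Qed.

Definition tensor_dual p : {linear tensor M N -> K^o} :=
  tensor_lift (tensor_dual_linl p) (tensor_dual_linr p).

(** Expand the first factor in [b], then, for each [i] separately, the second factor in [c i]. The
    basis of [N] must be allowed to vary with [i], because the pair v_n, w_n depends on the
    eigenvalue [n] of the vector it is tensored with. *)
Lemma dual_basis_tensor : dual_basis b d -> (forall i, dual_basis (c i) (e i)) ->
  dual_basis (fun p : I * J => b p.1 ⊗ c p.1 p.2) tensor_dual.
Proof.
move=> [bd bS] cd; split=> [[i j] [i' j']|].
  rewrite tensor_liftE /= bd xpair_eqE; case: eqVneq => [<-|_] /=.
    by rewrite scale1r (cd i).1.
  by rewrite scale0r.
apply: tensor_ind => [m n|x y IHx IHy]; last first.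
  rewrite [in LHS]IHx [in LHS]IHy -big_split; apply: eq_bigr => p _.
  by rewrite linearD scalerDl.
have suml (f : I -> M) n' : (\sum_i f i) ⊗ n' = \sum_i f i ⊗ n'.
  apply: (big_morph (fun m' => m' ⊗ n') (pure_tensorDl n')).
  by rewrite -(scale0r 0) pure_tensorZl scale0r.
have sumr m' (f : J -> N) : m' ⊗ (\sum_j f j) = \sum_j m' ⊗ f j.
  apply: (big_morph (pure_tensor m') (pure_tensorDr m')).
  by rewrite -(scale0r 0) pure_tensorZr scale0r.
rewrite {1}(bS m) suml; under eq_bigr => i _ do
  rewrite {1}((cd i).2 n) pure_tensorZl sumr scaler_sumr.
rewrite pair_bigA; apply: eq_bigr => p _.
rewrite /tensor_dual (tensor_liftE (tensor_dual_linl p) (tensor_dual_linr p)).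
by rewrite pure_tensorZr scalerA.
Qed.

End Tensor.

End DualBasis.

(** * Scalar identities for the eigenvalue equations and the change of basis *)

(* Over an abstract field because [ring] and [field] try to compute in the
   concrete fraction field [Cq R] and run for minutes there. *)
Section FieldIdentities.
Variable F : fieldType.
Implicit Types a b c r s t p : F.

(** Here and in the next lemma [r] is q, [p] and [s] are q^n and q^-n, and [e] chooses between v_n
    and w_n. The two identities compare the coefficients of x and of y in the eigenvalue
    equation. *)
Lemma eigenvalue_x r p s (e : bool) : r != 0 -> r ^+ 2 != 1 -> p * s = 1 ->
  (p - s) / (r - r^-1) * r^-1 + (if e then p else - s) =
  (if e then p * r - s * r^-1 else p * r^-1 - s * r) / (r - r^-1).
Proof. by move=> r0 r2 ps; case: e; field; rewrite r0 subr_eq0 r2. Qed.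

Lemma eigenvalue_y r p s (e : bool) : r != 0 -> r ^+ 2 != 1 -> p * s = 1 ->
  (p - s) / (r - r^-1) * ((if e then p else - s) * r) + 1 =
  (if e then p * r - s * r^-1 else p * r^-1 - s * r) / (r - r^-1) *
  (if e then p else - s).
Proof.
by move=> r0 r2 ps; case: e; field: ps; rewrite r0 subr_eq0 r2.
Qed.

Lemma scaled_combination_linear s t r c a b a' b' :
  (s * (c * a + a') + t * (c * b + b')) * r =
  c * ((s * a + t * b) * r) + (s * a' + t * b') * r.
Proof. by ring. Qed.

(** The matrix with rows (s, 1) and (p, -1), divided by p + s, inverts the matrix with columns (1,
    p) and (1, -s). This lemma is one of the two products; [eigdual_expansion] is the other. *)
Lemma eigdual_delta p s (i j : bool) : p + s != 0 ->
  ((if i then s else p) * 1 + (if i then 1 else -1) * (if j then p else - s)) / (p + s) =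
  (i == j)%:R.
Proof. by move=> p0; case: i; case: j => /=; field. Qed.

Lemma eigdual_expansion p s a b (X Y : 'cV[F]_2) : p * s = 1 -> p + s != 0 ->
  a *: X + b *: Y =
  (s * a + 1 * b) / (p + s) *: (1 *: X + p *: Y) +
  (p * a + -1 * b) / (p + s) *: (1 *: X + - s *: Y).
Proof.
move=> ps p0; rewrite !scalerDr !scalerA addrACA -!scalerDl.
by congr (_ *: _ + _ *: _); field: ps.
Qed.

Lemma cV2_coordE (v : 'cV[F]_2) :
  v = v 0 0 *: delta_mx 0 0 + v 1 0 *: delta_mx 1 0.
Proof.
apply/matrixP => i j; rewrite !mxE !ord1.
by case: i => [[|[|//]] ?]; rewrite /= ?mulr1 ?mulr0 ?addr0 ?add0r;
  congr (v _ _); apply: val_inj.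
Qed.

Lemma delta_combination_coord r s :
  let v : 'cV[F]_2 := r *: delta_mx 0 0 + s *: delta_mx 1 0 in (v 0 0 = r) * (v 1 0 = s).
Proof. by split; rewrite !mxE /= ?mulr1 ?mulr0 ?addr0 ?add0r. Qed.

End FieldIdentities.

(** * The basis v_n, w_n of V *)

Section Coordinates.
Variable R : realType.
Local Notation K := (Cq R).
Local Notation q := (qvar R).

(** The value at 1 is 2, which is nonzero in a numeric domain. *)
Lemma polyXnD1_neq0 (F : numDomainType) n : 'X^n + 1 != 0 :> {poly F}.
Proof.
apply/eqP => /(congr1 (fun p => p.[1])).
by rewrite !hornerE expr1n => /eqP; rewrite (pnatr_eq0 F 2).
Qed.

Lemma qvarXD1_neq0 m : q ^+ m + 1 != 0.
Proof.
rewrite /qvar -tofracXn -tofrac1 -tofracD tofrac_eq0.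
exact: polyXnD1_neq0.
Qed.

Lemma qvar_expz_neq0 (n : int) : q ^ n != 0.
Proof. by rewrite expfz_neq0 // qvar_neq0. Qed.

(** Up to swapping the summands the exponent is a natural number m, and q^m times the sum is q^(2m)
    + 1. *)
Lemma qvar_expzDV_neq0 (n : int) : q ^ n + q ^ (- n) != 0.
Proof.
move: (qvar_neq0 R) qvarXD1_neq0; move: (qvar R) => p p0 pX.
have nat_case (m : nat) : p ^+ m + (p ^+ m)^-1 != 0.
  have pm : p ^+ m != 0 by rewrite expf_neq0.
  have := pX (m + m)%N; apply: contra => /eqP e.
  by rewrite exprD -(mulfV pm) -mulrDr e mulr0.
case: n => m; first by rewrite -invr_expz nat_case.
by rewrite NegzE opprK -invr_expz addrC nat_case.
Qed.

Lemma qintN (n : int) : qint R (- n) = - qint R n.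
Proof. by rewrite /qint opprK -mulNr opprB. Qed.

Lemma qint1 : qint R 1 = 1.
Proof. by rewrite /qint expr1z -invr_expz expr1z; exact: mulfV (qvar_subV R). Qed.

Definition eigvec (n : int) (e : bool) : std R :=
  if e then vvec R n else wvec R n.

Definition eigval (n : int) (e : bool) : int := if e then n + 1 else n - 1.

(** Cramer's rule for v_n, w_n in the coordinates x, y; the determinant is the denominator up to
    sign. *)
Definition eigdual_fun (n : int) (e : bool) (v : std R) : K^o :=
  ((if e then q ^ (- n) else q ^ n) * (v : 'cV_2) 0 0 +
   (if e then 1 else - 1) * (v : 'cV_2) 1 0) / (q ^ n + q ^ (- n)).

Fact eigdual_linear n e : linear (eigdual_fun n e).
Proof.
by move=> c v w; rewrite /eigdual_fun !mxE; exact: scaled_combination_linear.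
Qed.

HB.instance Definition _ n e :=
  GRing.isLinear.Build K (std R) K^o *:%R (eigdual_fun n e) (eigdual_linear n e).
Definition eigdual n e : {linear std R -> K^o} := eigdual_fun n e.

(** The coefficient 1 stays explicit so that both vectors are instances of a general combination of
    x and y. *)
Lemma eigvecE n e :
  eigvec n e = 1 *: (delta_mx 0 0 : 'cV_2) +
               (if e then q ^ n else - q ^ (- n)) *: (delta_mx 1 0 : 'cV_2).
Proof. by rewrite scale1r; case: e; rewrite ?scaleNr. Qed.

Lemma qvar_expzN n : q ^ n * q ^ (- n) = 1.
Proof. by rewrite -invr_expz; exact: mulfV (qvar_expz_neq0 n). Qed.

Lemma eigvec_dual_basis n : dual_basis (eigvec n) (eigdual n).
Proof.
split=> [i j|v].
  rewrite /= /eigdual_fun eigvecE !delta_combination_coord.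
  exact: eigdual_delta (qvar_expzDV_neq0 n).
rewrite big_bool !eigvecE [LHS]cV2_coordE.
exact: eigdual_expansion (qvar_expzN n) (qvar_expzDV_neq0 n).
Qed.

End Coordinates.

(** * Linearity of a module action *)

Section Action.
Variables (K : fieldType) (A : algType K) (M : rep A).

Lemma actD a b (m : M) : act (a + b) m = act a m + act b m.
Proof. by have := act_linear m 1 a b; rewrite !scale1r. Qed.

Lemma actZ c a (m : M) : act (c *: a) m = c *: act a m.
Proof.
have a0 : act 0 m = 0 by apply: (addrI (act 0 m)); rewrite -actD !addr0.
by have := act_linear m c a 0; rewrite a0 !addr0.
Qed.

Lemma act_scale u c (m : M) : act u (c *: m) = c *: act u m.
Proof. exact: linearZ. Qed.

Lemma act_comb u a b (m m' : M) :
  act u (a *: m + b *: m') = a *: act u m + b *: act u m'.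
Proof. by rewrite linearD !linearZ. Qed.

End Action.

(** With [m] and [m'] standing for x and y, K^-1 scales them by r^-1 and r while B swaps them. The
    two hypotheses equate the coefficients of [m] and of [m']. *)
Lemma comb_rec (K : fieldType) (M : lmodType K) (c r t l : K) (m m' : M) :
  c * r^-1 + t = l -> c * (t * r) + 1 = l * t ->
  c *: (1 *: (r^-1 *: m) + t *: (r *: m')) + (1 *: m' + t *: m) =
  l *: (1 *: m + t *: m').
Proof.
move=> lx ly; rewrite !scalerDr !scalerA !mul1r mulr1 -ly -lx.
by rewrite !scalerDl !scale1r [m' + _]addrC addrACA.
Qed.

(** * Action of C, K^-1 and B on V *)

Section StandardAction.
Variable R : realType.
Local Notation q := (qvar R).
Local Notation x := (std_x R).
Local Notation y := (std_y R).

Lemma std_Cx : act (uC R) x = q *: x.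
Proof. by rewrite actM std_D2x std_D1x. Qed.

Lemma std_Cy : act (uC R) y = q *: y.
Proof. by rewrite actM std_D2y act_scale std_D1y. Qed.

Lemma std_KVx : act uKV x = q^-1 *: x.
Proof.
have D1Vx : act uD1V x = q^-1 *: x by rewrite std_gen_x; case: (std_mx_xy R genD1V).
by rewrite actM D1Vx act_scale std_D2x.
Qed.

Lemma std_KVy : act uKV y = q *: y.
Proof.
have D1Vy : act uD1V y = y by rewrite std_gen_y; case: (std_mx_xy R genD1V).
by rewrite actM D1Vy std_D2y.
Qed.

Lemma std_Bx : act (uB R) x = y.
Proof.
rewrite actD actZ actM std_KVx std_Fx act_scale std_Ex.
by rewrite !scaler0 add0r.
Qed.

Lemma std_By : act (uB R) y = x.
Proof.
rewrite actD actZ actM std_KVy std_Fy act_scale std_Ey.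
by rewrite addr0 scalerA mulVf ?qvar_neq0 // scale1r.
Qed.

Lemma std_C (v : std R) : act (uC R) v = q *: v.
Proof.
have {1 2}-> : v = (v : 'cV_2) 0 0 *: x + (v : 'cV_2) 1 0 *: y by exact: cV2_coordE.
by rewrite act_comb std_Cx std_Cy scalerDr !scalerA ![q * _]mulrC.
Qed.

Lemma qint_eigval n e :
  qint R (eigval n e) =
  (if e then q ^ n * q - q ^ (- n) * q^-1 else q ^ n * q^-1 - q ^ (- n) * q) /
  (q - q^-1).
Proof.
have q0 := qvar_neq0 R; rewrite /qint /eigval.
case: e; first by rewrite opprD !expfzDr.
by rewrite opprB [1 - n]addrC !expfzDr.
Qed.

(** The left side is the effect of B ⊗ K^-1 + 1 ⊗ B on the second tensor factor when B acts by [n]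
    on the first. *)
Lemma eigvec_rec n e :
  qint R n *: act uKV (eigvec R n e) + act (uB R) (eigvec R n e) =
  qint R (eigval n e) *: eigvec R n e.
Proof.
pose t := if e then q ^ n else - q ^ (- n).
have -> : eigvec R n e = 1 *: x + t *: y by exact: eigvecE.
rewrite !act_comb std_KVx std_KVy std_Bx std_By qint_eigval.
apply: comb_rec.
  exact: eigenvalue_x (qvar_neq0 R) (qvar_sq R) (qvar_expzN R n).
exact: eigenvalue_y (qvar_neq0 R) (qvar_sq R) (qvar_expzN R n).
Qed.

Lemma eigvec0_B e :
  act (uB R) (eigvec R 0 e) = (if e then 1 else -1) *: eigvec R 0 e.
Proof.
have -> : eigvec R 0 e = 1 *: x + (if e then 1 else - 1) *: y.
  by rewrite [LHS]eigvecE oppr0 !expr0z.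
rewrite act_comb std_Bx std_By addrC; case: e.
  by rewrite !scale1r.
by rewrite scalerDr !scalerA !mulN1r opprK.
Qed.

End StandardAction.

(** * Stable lines, direct sums of lines, and eigenspaces *)

Section Lines.
Variables (K : fieldType) (A : algType K) (M : rep A).

Section LineSubrep.
Variables (x : M) (x_stable : forall a, line x (act a x)).

Fact line0 : line x 0. Proof. by exists 0; rewrite scale0r. Qed.
Fact lineP c u v : line x u -> line x v -> line x (c *: u + v).
Proof.
by move=> [a ->] [b ->]; exists (c * a + b); rewrite scalerA scalerDl.
Qed.
Fact line_act a u : line x u -> line x (act a u).
Proof.
move=> [c ->]; have [b ab] := x_stable a.
by exists (c * b); rewrite linearZ /= ab scalerA.
Qed.

Definition line_subrep : subrep M := Subrep line0 lineP line_act.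

Lemma line_subrepP (l : subrep_rep line_subrep) : line x (val l).
Proof. by have /asboolP := valP l. Qed.

Lemma line_subrep_one_dimensional : x != 0 -> one_dimensional (subrep_rep line_subrep).
Proof.
move=> x0; have xP : x \in subrep_pred line_subrep.
  by apply/asboolP; exists 1; rewrite scale1r.
exists (exist _ x xP); first by apply: contra x0 => /eqP/(congr1 val) /= ->.
apply/seteqP; split=> // l _; have [c lE] := line_subrepP l.
by exists c; apply: val_inj.
Qed.

Lemma line_subrep_act a c : act a x = c *: x ->
  forall l : subrep_rep line_subrep, act a l = c *: l.
Proof.
move=> ax l; apply: val_inj; have [b lE] := line_subrepP l.
by rewrite /= lE linearZ /= ax !scalerA mulrC.
Qed.

End LineSubrep.

Section LineSum.
Variables (I : finType) (b : I -> M) (d : I -> {linear M -> K^o}).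
Hypothesis bd : dual_basis b d.

(** The components are forced: [d i] kills every line other than the i-th, so [d i u] determines the
    component of [u] there. *)
Lemma dual_basis_direct_sum (S : I -> subrep M) :
  (forall i, S i = line (b i) :> set M) -> direct_sum S.
Proof.
have [dE dS] := bd.
move=> SE u; exists [ffun i => d i u *: b i]; split.
  split=> [i|]; first by rewrite SE ffunE; exists (d i u).
  by rewrite {1}[u]dS; apply: eq_bigr => i _; rewrite ffunE.
move=> f [fS uE]; apply/ffunP => i; rewrite ffunE.
have d_f j : d i (f j) = (i == j)%:R * d i (f i).
  have := fS j; rewrite SE => -[c fj].
  case: eqVneq => [<-|ij]; first by rewrite mul1r.
  by rewrite fj linearZ /= dE (negPf ij) mul0r [LHS]mulr0.
have -> : d i u = d i (f i).
  rewrite uE linear_sum (bigD1 i) //= big1 ?addr0 // => j ji.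
  by rewrite d_f eq_sym (negPf ji) mul0r.
have := fS i; rewrite SE => -[c ->].
by rewrite linearZ /= dE eqxx [c *: _]mulr1.
Qed.

(** Each [d j] is an eigenvector of the transpose of [a]. Applied to [a u = lam i u] it gives (lam j
    - lam i) d_j(u) = 0, so only the i-th coordinate of [u] survives. *)
Lemma dual_basis_eigenspace a (lam : I -> K) i : injective lam ->
  (forall i, act a (b i) = lam i *: b i) -> act_eigenspace M a (lam i) = line (b i).
Proof.
have [dE dS] := bd.
move=> lam_inj ab; apply/seteqP; split=> [u au|_ [c ->]]; last first.
  by rewrite /act_eigenspace /= linearZ /= ab !scalerA mulrC.
have d_act j : d j (act a u) = lam j * d j u.
  rewrite {1}[u]dS !linear_sum (bigD1 j) //= big1 ?addr0 => [|k kj].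
    by rewrite linearZ /= ab !linearZ /= dE eqxx [lam j *: _]mulr1 mulrC.
  by rewrite linearZ /= ab !linearZ /= dE eq_sym (negPf kj) !scaler0.
exists (d i u); rewrite {1}[u]dS (bigD1 i) //= big1 ?addr0 // => j ji.
suff -> : d j u = 0 by rewrite scale0r.
have /eqP : (lam j - lam i) * d j u = 0.
  by rewrite mulrBl -d_act au linearZ subrr.
by rewrite mulf_eq0 subr_eq0 (inj_eq lam_inj) (negPf ji) => /eqP.
Qed.

End LineSum.

End Lines.

(** * Indexing by weight and multiplicity *)

(** Enumerate each fibre of [wt] separately; its cardinality is the prescribed binomial
    coefficient. *)
Lemma weight_bijection (I : finType) (wt : I -> nat) n :
  (forall k, #|[pred i | wt i == k]| = 'C(n, k)) ->
  exists2 h : {k : 'I_n.+1 & 'I_('C(n, k))} -> I,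
    bijective h & forall t, wt (h t) = tag t.
Proof.
move=> wtC.
pose h (t : {k : 'I_n.+1 & 'I_('C(n, k))}) : I :=
  enum_val (cast_ord (esym (wtC (tag t))) (tagged t)).
have wt_h t : wt (h t) = tag t.
  by have := enum_valP (cast_ord (esym (wtC (tag t))) (tagged t)); rewrite inE => /eqP.
exists h => //; apply: inj_card_bij => [[k j] [k' j'] hE|].
  (* Equal images have equal weights, hence lie in one fibre, where the enumeration is injective. *)
  pose T (k : 'I_n.+1) := 'I_('C(n, k)).
  have /= kE := wt_h (Tagged T j); have /= k'E := wt_h (Tagged T j').
  have kk : k = k' by apply: val_inj; rewrite /= -kE -k'E hE.
  move: kk j' {k'E} hE => <- j' hE.
  by have /cast_ord_inj/= -> := enum_val_inj hE.
(* A weight above n would have an empty fibre, its binomial coefficient being 0; so the fibres over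
   ['I_n.+1] exhaust [I], and the cardinalities agree. *)
have wt_lt i : (wt i < n.+1)%N.
  by rewrite ltnS -bin_gt0 -wtC; apply/card_gt0P; exists i; rewrite inE.
rewrite card_tagged sumnE big_map -sum1_card big_enum /=.
rewrite (partition_big (fun i => inord (wt i) : 'I_n.+1) predT) //=.
apply: leq_sum => k _; rewrite card_ord -wtC -sum1_card.
apply/eq_leq/eq_bigl => i; rewrite inE.
by rewrite -val_eqE /= inordK.
Qed.

(** * Eigenbases of the tensor powers of V *)

Section TensorPowers.
Variable R : realType.
Local Notation q := (qvar R).

(** It suffices to check the generators; C^-1 acts on [u] by c^-1, which is why [c] must be
    nonzero. *)
Lemma iota_line_stable (M : rep (Uiota R)) (u : M) (c b : Cq R) : c != 0 ->
  act iC u = c *: u -> act iB u = b *: u -> forall a, line u (act a u).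
Proof.
move=> c0 Cu Bu a; move: {2}(iota_incl R a) (erefl (iota_incl R a)) => a' aE.
have : in_subalg (@iota_gens R) a' by rewrite -aE; apply/asboolP/(valP a).
(* The induction runs over elements of U_q(gl_2), where membership is inductive, so each case
   supplies a preimage in U^iota; injectivity of the inclusion identifies it with [a]. *)
move=> gen; suff [a1 a1E Pa1] : exists2 a1, iota_incl R a1 = a' & line u (act a1 u).
  by have <- : a1 = a by apply: subalg_incl_inj; rewrite a1E.
elim: gen => {a a' aE}.
- move=> _ [->|->|->].
  + by exists iC => //; exists c.
  + exists iCV => //; exists c^-1.
    have CVC : iCV * iC = 1 :> Uiota R.
      apply: (@subalg_incl_inj _ _ (@iota_gens R)).
      rewrite [LHS]rmorphM [RHS]rmorph1 /= /subalg_val /=.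
      rewrite mulrA -(mulrA uD2V) (relD1VK (uq_gen_relations R)) mulr1.
      exact: relD2VK (uq_gen_relations R).
    by rewrite -{2}[u]act1 -CVC actM Cu act_scale scalerA mulVf // scale1r.
  + by exists iB => //; exists b.
- by exists 1; [exact: rmorph1 | exists 1; rewrite act1 scale1r].
- move=> _ _ _ [a <- [c1 au]] _ [a' <- [c2 a'u]].
  exists (a + a'); first exact: raddfD.
  by exists (c1 + c2); rewrite actD au a'u scalerDl.
- move=> _ _ _ [a <- [c1 au]] _ [a' <- [c2 a'u]].
  exists (a * a'); first exact: rmorphM.
  by exists (c2 * c1); rewrite actM a'u act_scale au scalerA.
- move=> c3 _ _ [a <- [c1 au]].
  exists (c3 *: a); first exact: linearZ.
  by exists (c3 * c1); rewrite actZ au scalerA.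
Qed.

Lemma eigvec_tensor (M : rep (Uiota R)) (z : M) n e :
  act iB z = qint R n *: z ->
  act (r := coideal_tensor M (std R)) iB (z ⊗ eigvec R n e) =
  qint R (eigval n e) *: (z ⊗ eigvec R n e).
Proof.
move=> zB; rewrite act_iB_tensor zB pure_tensorZl -!pure_tensorZr -pure_tensorDr.
by rewrite eigvec_rec.
Qed.

Lemma act_eigenvector_tensor (M : rep (Uiota R)) (z : M) n e :
  act_eigenvector M iB (qint R n) z ->
  act_eigenvector (coideal_tensor M (std R)) iB (qint R (eigval n e))
    (z ⊗ eigvec R n e).
Proof.
move=> [z0 zB]; split; last exact: eigvec_tensor.
by apply: pure_tensor_neq0 => //; exact: dual_basis_neq0 (eigvec_dual_basis R n).
Qed.

(** C is group-like and acts by q on V, so every tensor factor contributes one q. *)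
Lemma std_power_C n (z : std_power R n.+1) : act (uC R) z = q ^+ n.+1 *: z.
Proof.
elim: n z => [|n IHn] z; first by rewrite expr1; exact: std_C.
have C_pure (m : std_power R n.+1) (v : std R) :
    act (r := uq_tensor (std_power R n.+1) (std R)) (uC R) (m ⊗ v) =
    act (uC R) m ⊗ act (uC R) v.
  have -> : act (r := uq_tensor (std_power R n.+1) (std R)) (uC R) (m ⊗ v) =
    outer_act (Delta (uC R)) (m ⊗ v) by [].
  by rewrite DeltaC outer_act_pure.
elim/tensor_ind: z => [m v|z z' IHz IHz'].
  by rewrite [LHS]C_pure IHn std_C pure_tensorZl pure_tensorZr scalerA -exprSr.
have -> : act (r := std_power R n.+2) (uC R) (z + z') =
   act (r := std_power R n.+2) (uC R) z + act (r := std_power R n.+2) (uC R) z'.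
  exact: linearD.
by rewrite IHz IHz' -scalerDr.
Qed.

(** [wt] counts the factors of type w: each v raises the index of the eigenvalue by 1 and each w
    lowers it by 1, which gives n + 1 - 2 wt. *)
Lemma std_power_eigenbasis n :
  exists (I : finType) (wt : I -> nat) (b : I -> std_power R n.+1)
    (d : I -> {linear std_power R n.+1 -> (Cq R)^o}),
  [/\ dual_basis b d,
      forall i, act (r := iota_restrict (std_power R n.+1)) iB (b i) =
        qint R (n.+1%:Z - 2 * (wt i)%:Z) *: b i &
      forall k, (\sum_i (wt i == k))%N = 'C(n.+1, k)].
Proof.
elim: n => [|n [I [wt [b [d [bd bB wtC]]]]]].
  exists bool, (fun e => ~~ e : nat), (eigvec R 0), (eigdual R 0); split.
  - exact: eigvec_dual_basis.
  - move=> e; rewrite [LHS]eigvec0_B; congr (_ *: _).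
    case: e; first by rewrite mulr0 subr0 qint1.
    by rewrite (_ : 1%:Z - 2 * _ = - 1) // qintN qint1.
  - by move=> [|[|k]]; rewrite big_bool.
(* B acts on [b i] by [N i], so [b i] is paired with the basis v, w of index [N i]. *)
pose N i := n.+1%:Z - 2 * (wt i)%:Z.
exists (I * bool)%type, (fun p => wt p.1 + ~~ p.2)%N,
  (fun p => b p.1 ⊗ eigvec R (N p.1) p.2),
  (tensor_dual d (fun i => eigdual R (N i))); split.
- exact: (dual_basis_tensor bd (fun i => eigvec_dual_basis R (N i))).
- move=> [i e] /=.
  (* The restricted U_q(gl_2)-structure is exchanged for the coideal one, to which the eigenvector
     recursion applies. *)
  rewrite [LHS](iota_restrict_tensor (M := std_power R n.+1) iB).
  rewrite [LHS](eigvec_tensor e (bB i)); congr (qint R _ *: _).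
  by rewrite /eigval /N; case: e => /=; rewrite ?addn0 ?addn1 ?intS; ring.
(* Split by the last factor: v keeps the weight and w adds 1, so the counts obey Pascal's rule. *)
move=> k; rewrite -(pair_bigA _ (fun i (e : bool) => (wt i + ~~ e == k)%N : nat)) /=.
under eq_bigr => i _ do rewrite big_bool addn0 addn1.
rewrite big_split /= wtC; case: k => [|k].
  by rewrite big1 // !bin0.
by rewrite [RHS]binS -[in 'C(_, k)]wtC.
Qed.

End TensorPowers.

Lemma line_subrep_is_L (R : realType) n m (M : rep (Uiota R)) (u : M)
    (u_stable : forall a, line u (act a u)) :
  u != 0 -> act iC u = qvar R ^+ n *: u -> act iB u = qint R m *: u ->
  is_L n m (subrep_rep (line_subrep u_stable)).
Proof.
by move=> u0 uC uB; split; [exact: line_subrep_one_dimensional | exact: line_subrep_act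
  | exact: line_subrep_act].
Qed.

(** * The decompositions of V and of its tensor powers *)

Section Decomposition.
Variable R : realType.

Lemma std_decomposition :
  exists S : bool -> subrep (iota_restrict (std R)),
     [/\ S true = line (vvec R 0) :> set (std R),
         S false = line (wvec R 0) :> set (std R),
         forall b, one_dimensional (subrep_rep (S b)),
         S true = act_eigenspace (iota_restrict (std R)) iB 1 :> set (std R) &
         S false = act_eigenspace (iota_restrict (std R)) iB (- 1) :> set (std R)]
     /\ direct_sum S.
Proof.
pose M := iota_restrict (std R); pose b : bool -> M := eigvec R 0.
have bd : dual_basis b (eigdual R 0) := eigvec_dual_basis R 0.
pose lam (e : bool) : Cq R := if e then 1 else -1.
have bB e : act iB (b e) = lam e *: b e := eigvec0_B R e.
have bC e : act iC (b e) = qvar R *: b e := std_C (b e).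
have stable e := iota_line_stable (qvar_neq0 R) (bC e) (bB e).
have lam_inj : injective lam.
  (* At n = 0 the fact q^n + q^-n <> 0 says 1 + 1 <> 0. Distinct eigenvalues make the two lines full
     eigenspaces. *)
  have neq1N1 : 1 != -1 :> Cq R.
    by have := qvar_expzDV_neq0 R 0; rewrite oppr0 expr0z addr_eq0.
  by case=> [] [] // /eqP; rewrite /lam ?(negPf neq1N1) // eq_sym (negPf neq1N1).
exists (fun e => line_subrep (stable e)); split; last exact: dual_basis_direct_sum bd _ _.
split=> //.
- by move=> e; apply: line_subrep_one_dimensional; exact: dual_basis_neq0 bd.
- by rewrite -[1]/(lam true) (dual_basis_eigenspace bd true lam_inj bB).
- by rewrite -[-1]/(lam false) (dual_basis_eigenspace bd false lam_inj bB).
Qed.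

(** The eigenbasis is renumbered by pairs of a weight k and a position among the vectors of that
    weight; each vector then spans a copy of L([n - 2k]). *)
Lemma std_power_decomposition (n : nat) : (0 < n)%N ->
     exists S : {k : 'I_n.+1 & 'I_('C(n, k))} -> subrep (iota_restrict (std_power R n)),
       (forall (k : 'I_n.+1) (j : 'I_('C(n, k))),
          is_L n (n%:Z - 2 * k%:Z) (subrep_rep (S (Tagged (fun k : 'I_n.+1 => 'I_('C(n, k))) j)))) /\
       direct_sum S.
Proof.
case: n => // n _; have [I [wt [b [d [bd bB wtC]]]]] := std_power_eigenbasis R n.
have [|h hbij wt_h] := @weight_bijection I wt n.+1.
  by move=> k; rewrite -wtC -sum1_card [LHS]big_mkcond; apply: eq_bigr => i _; rewrite inE; case: eqP.
pose M := iota_restrict (std_power R n.+1).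
have hd := dual_basis_reindex hbij bd.
have bC i : act (r := M) iC (b i) = qvar R ^+ n.+1 *: b i := std_power_C (b i).
have qn0 : qvar R ^+ n.+1 != 0 by rewrite expf_neq0 // qvar_neq0.
have stable t := iota_line_stable qn0 (bC (h t)) (bB (h t)).
exists (fun t => line_subrep (stable t)); split; last exact: (dual_basis_direct_sum (M := M) hd).
move=> k j; apply: line_subrep_is_L; [exact: dual_basis_neq0 bd | exact: bC |].
by rewrite [LHS]bB wt_h.
Qed.

End Decomposition.

Theorem theoremA (R : realType) :
  (* (i) *)
  (exists S : bool -> subrep (iota_restrict (std R)),
     [/\ S true = line (vvec R 0) :> set (std R),
         S false = line (wvec R 0) :> set (std R),
         forall b, one_dimensional (subrep_rep (S b)),
         S true = act_eigenspace (iota_restrict (std R)) iB 1 :> set (std R) &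
         S false = act_eigenspace (iota_restrict (std R)) iB (- 1) :> set (std R)]
     /\ direct_sum S) /\
  (* (ii) *)
  (forall (M : rep (Uiota R)) (z : M) (n : int),
     act_eigenvector M iB (qint R n) z ->
     act_eigenvector (coideal_tensor M (std R)) iB (qint R (n + 1))
       (z ⊗ vvec R n)) /\
  (* (iii) *)
  (forall (M : rep (Uiota R)) (z : M) (n : int),
     act_eigenvector M iB (qint R n) z ->
     act_eigenvector (coideal_tensor M (std R)) iB (qint R (n - 1))
       (z ⊗ wvec R n)) /\
  (* (iv) *)
  (forall n : nat, (0 < n)%N ->
     exists S : {k : 'I_n.+1 & 'I_('C(n, k))} -> subrep (iota_restrict (std_power R n)),
       (forall (k : 'I_n.+1) (j : 'I_('C(n, k))),
          is_L n (n%:Z - 2 * k%:Z) (subrep_rep (S (Tagged (fun k : 'I_n.+1 => 'I_('C(n, k))) j)))) /\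
       direct_sum S).
Proof.
split; first exact: std_decomposition.
split; first by move=> M z n; exact: (@act_eigenvector_tensor R M z n true).
split; first by move=> M z n; exact: (@act_eigenvector_tensor R M z n false).
exact: std_power_decomposition.
Qed.
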